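(* Let $n\ge 4$ and $m=n-2$. The lower coefficient functions $A_2,C_3,\ldots,C_{n-2}$ of $K_n$ (defined in the context) are part of a polynomial coordinate system on the source of $K_n$, obtained by coordinate changes that fix the source coordinate $x$. That is, there are polynomials $s_{n-1},s_n\in\mathbb C[x,y,z_3,\ldots,z_n]$ such that $$(x,\,A_2,\,C_3,\ldots,C_{n-2},\,s_{n-1},\,s_n):\mathbb A^n\to\mathbb A^n$$ is a polynomial automorphism (with polynomial inverse). Consequently, for every tuple $\lambda=(\lambda_2,\ldots,\lambda_{n-2})\in\mathbb C^{n-3}$, fixing $A_2=\lambda_2$ and $C_j=\lambda_j$ for $3\le j\le n-2$ and using $(x,s_{n-1},s_n)$ as source coordinates on the resulting locus, the remaining coefficients $(r,q,b)=(C_{n-1},C_n,A_0)$ define a Keller map $$E_{n,\lambda}:\mathbb A^3\to\mathbb A^3_{r,q,b}$$ of geometric degree $nm$. The same holds at every intermediate step of a successive descent: for every $k$ with $1\le k\le n-2$ and all $\lambda_2,\ldots,\lambda_k\in\mathbb C$ (no condition when $k=1$), the closed subvariety $\{A_2=\lambda_2,\ C_j=\lambda_j\ (3\le j\le k)\}\subset\mathbb A^n$ is isomorphic to $\mathbb A^d$ with $d=n-k+1$, and the map $\mathbb A^d\to\mathbb A^d$ given on it by the remaining coefficient functions is a Keller map of geometric degree $nm$.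
   Context: All varieties are over $\mathbb C$. A Keller map is a polynomial map $\mathbb A^N\to\mathbb A^N$ whose Jacobian determinant is a nonzero constant. The geometric degree of such a map $F$ is the degree of the function field extension $\mathbb C(\mathbb A^N)/F^*\mathbb C(\mathbb A^N)$, equivalently the number of points in a generic fibre. Definition of $K_n$. For $n\ge 3$ use coordinates $(x,y,z_3,\ldots,z_n)$ on $\mathbb A^n$, put $p=1+xy$, and for an auxiliary variable $T$ let $$\Phi_n(T)=(1-yT)^{n-1}(pT-x)+(pT-x)^2\Bigl[ny\bigl(yT+\tfrac12\bigr)+z_3\bigl(pT+\tfrac x2\bigr)+\sum_{j=4}^n z_jT^{j-2}\Bigr].$$ It has degree at most $n$ in $T$ and its coefficient of $T$ equals $1$. Name its other coefficients by $$\Phi_n(T)=\sum_{j=3}^n C_jT^j+A_2T^2+T-A_0,\qquad K_n=(C_3,\ldots,C_n,A_2,A_0):\mathbb A^n\to\mathbb A^n.$$ The lower coefficients are $\lambda_2=A_2$ and $\lambda_j=C_j$ for $3\le j\le n-2$; the other coefficients are $r=C_{n-1}$, $q=C_n$, $b=A_0$. A successive coordinate descent fixes a prefix $\lambda_2,\ldots,\lambda_k$ of the lower coefficients to complex values and keeps the remaining lower coefficients and $r,q,b$ free. *)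

(* Defs.v *)
From HB Require Import structures.
From mathcomp Require Import all_boot all_order all_algebra.
From mathcomp Require Import fraction complex mpoly.
From mathcomp Require Import reals.

Set Implicit Arguments.
Unset Strict Implicit.
Unset Printing Implicit Defensive.

Import GRing.Theory.
Local Open Scope ring_scope.

(* A polynomial map A^M -> A^N is the N-tuple of its components, which are
   polynomials in M variables. The complex numbers are R[i], R : realType. *)

Section PolynomialMaps.
Variable R : realType.
Local Notation C := R[i].

Definition id_map (n : nat) : n.-tuple {mpoly C[n]} := [tuple 'X_i | i < n].

(* F after G *)
Definition comp_map (l n m : nat) (F : m.-tuple {mpoly C[n]})
    (G : n.-tuple {mpoly C[l]}) : m.-tuple {mpoly C[l]} :=
  [tuple tnth F i \mPo G | i < m].

Definition inverse_maps (n : nat) (F G : n.-tuple {mpoly C[n]}) : Prop :=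
  comp_map F G = id_map n /\ comp_map G F = id_map n.

Definition eval_map (n m : nat) (F : m.-tuple {mpoly C[n]})
    (u : {ffun 'I_n -> C}) : {ffun 'I_m -> C} :=
  [ffun i => (tnth F i).@[u]].

Definition jacobian (n : nat) (F : n.-tuple {mpoly C[n]}) :
    'M[{mpoly C[n]}]_n :=
  \matrix_(i, j) mderiv j (tnth F i).

Definition keller (n : nat) (F : n.-tuple {mpoly C[n]}) : Prop :=
  exists2 c : C, c != 0 & \det (jacobian F) = c%:MP.

(* f belongs to F^* C(A^n) *)
Definition pullback_field (n : nat) (F : n.-tuple {mpoly C[n]})
    (f : {fraction {mpoly C[n]}}) : Prop :=
  exists g h : {mpoly C[n]},
    h \mPo F != 0 /\ f = tofrac (g \mPo F) / tofrac (h \mPo F).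

(* [K : L] = d, for a subfield L of K *)
Definition extension_degree (K : fieldType) (L : K -> Prop) (d : nat) : Prop :=
  exists e : 'I_d -> K,
    (forall f : K, exists2 c : 'I_d -> K,
       forall i, L (c i) & f = \sum_(i < d) c i * e i) /\
    (forall c : 'I_d -> K, (forall i, L (c i)) ->
       \sum_(i < d) c i * e i = 0 -> forall i, c i = 0).

Definition geometric_degree (n : nat) (F : n.-tuple {mpoly C[n]})
    (d : nat) : Prop :=
  extension_degree (pullback_field F) d.

(* phi is an isomorphism from A^d onto the closed subvariety of A^n whose set
   of points is V; regular maps on V are restrictions of polynomial maps. *)
Definition isomorphism_onto (d n : nat) (phi : n.-tuple {mpoly C[d]})
    (V : {ffun 'I_n -> C} -> Prop) : Prop :=
  exists psi : d.-tuple {mpoly C[n]},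
    (forall u, V (eval_map phi u) /\ eval_map psi (eval_map phi u) = u) /\
    (forall v, V v -> eval_map phi (eval_map psi v) = v).

End PolynomialMaps.

Section KellerFamily.
Variable R : realType.
Local Notation C := R[i].

(* The i-th coordinate of A^n, counting from 0 (and 0 if n <= i). *)
Definition coordinate (n i : nat) : {mpoly C[n]} :=
  if insub i is Some j then 'X_(j : 'I_n) else 0.

Definition xc (n : nat) : {mpoly C[n]} := coordinate n 0.
Definition yc (n : nat) : {mpoly C[n]} := coordinate n 1.
(* z_j, for 3 <= j <= n *)
Definition zc (n j : nat) : {mpoly C[n]} := coordinate n j.-1.

(* The indeterminate T is 'X : {poly {mpoly C[n]}}. *)
Definition Phi (n : nat) : {poly {mpoly C[n]}} :=
  let x := xc n in
  let y := yc n in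
  let p := 1 + x * y in
  let half : {mpoly C[n]} := (2%:R^-1)%:MP in
  (1 - y *: 'X) ^+ n.-1 * (p *: 'X - x%:P)
  + (p *: 'X - x%:P) ^+ 2 *
    ((n%:R * y) *: (y *: 'X + half%:P)
     + zc n 3 *: (p *: 'X + (half * x)%:P)
     + \sum_(4 <= j < n.+1) zc n j *: 'X^(j - 2)).

(* C_j for 3 <= j <= n, and A_2 for j = 2 *)
Definition coefT (n j : nat) : {mpoly C[n]} := (Phi n)`_j.
Definition A0 (n : nat) : {mpoly C[n]} := - (Phi n)`_0.

(* (x, A_2, C_3, ..., C_(n-2), s, s') *)
Definition source_coordinates (n : nat) (s s' : {mpoly C[n]}) :
    n.-tuple {mpoly C[n]} :=
  [tuple if i == 0%N :> nat then xc n
         else if (i < n - 2)%N then coefT n i.+1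
         else if i == (n - 2)%N :> nat then s else s' | i < n].

(* A tuple (lambda_2, ..., lambda_k) is stored with lambda_j at position j - 2.
   The slice is (u, v, w) |-> (u, lambda_2, ..., lambda_(n-2), v, w). *)
Definition slice (n : nat) (lam : (n - 3).-tuple C) : n.-tuple {mpoly C[3]} :=
  [tuple if i == 0%N :> nat then coordinate 3 0
         else if (i < n - 2)%N then (lam`_(i.+1 - 2))%:MP
         else if i == (n - 2)%N :> nat then coordinate 3 1
         else coordinate 3 2 | i < n].

(* G is meant to be the inverse of a map source_coordinates n s s'. *)
Definition E_map (n : nat) (G : n.-tuple {mpoly C[n]})
    (lam : (n - 3).-tuple C) : 3.-tuple {mpoly C[3]} :=
  comp_map [tuple coefT n n.-1; coefT n n; A0 n] (comp_map G (slice lam)).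

(* {A_2 = lambda_2, C_j = lambda_j (3 <= j <= k)} *)
Definition locus (n k : nat) (lam : (k - 1).-tuple C)
    (v : {ffun 'I_n -> C}) : Prop :=
  forall j : nat, (2 <= j <= k)%N -> (coefT n j).@[v] = lam`_(j - 2).

(* The coefficients of T^(k+1), ..., T^n, followed by A_0. *)
Definition remaining (n k : nat) : (n - k + 1).-tuple {mpoly C[n]} :=
  [tuple if (i < n - k)%N then coefT n (k + 1 + i) else A0 n | i < n - k + 1].

End KellerFamily.

(* Main.v *)
From HB Require Import structures.
Require Import Defs.
From mathcomp Require Import all_boot all_order all_algebra all_field.
From mathcomp Require Import fraction complex mpoly.
From mathcomp Require Import reals.
From mathcomp Require Import boolp ring zify.

(** Put [p = 1 + x y], [l = p T - x] and [g = 1 - y T], so that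
    [Phi = g^(n-1) l + l^2 B] where [B] has degree at most [n - 2] in [T].

    _Degree._ At [t = x / p] the polynomial [Phi] vanishes and its derivative is
    [1 / p^(n-2)] ([phi_root], [phi_deriv_root]). Conversely, let [f] have degree
    at most [n] and coefficient 1 at [T], let [t] be a nonzero root of [f], and
    let [p^(n-2) = 1 / f'(t)]. With [x = t p] and [1 + x y = p], the polynomial
    [f - g^(n-1) l] has a double root at [t], hence is a multiple of [l^2], and
    the quotient has the form of [B]: so [f] is the value of [Phi] at a point
    ([phi_poly_of_root]). A general fibre therefore consists of [n - 2] points
    [p] for each of the [n] roots [t], and this remains so when lower
    coefficients are fixed, because the general [f] with these coefficients has
    simple nonzero roots ([generic_target]). Accordingly the monomials
    [t^i / p^j] with [i < n] and [j < n - 2] form a basis of the function field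
    over the pulled back one. They are independent because a relation can be
    evaluated on a general fibre ([monomials_independent]); their span is a ring
    ([monomials_span]), is closed under inverses ([lspanV]), and contains the
    coordinates of the source ([coordinates_rational]).

    _Keller property._ A polynomial without zeros is constant, so that it is
    enough to show that no tangent vector is killed. If the first-order
    variation of [g^(n-1) l + l^2 B] vanishes, reductions modulo [l] and
    divisions by [l] show that the variations of [x], [y] and [z_j] all vanish
    ([tangent_stationary], [tangent_last]). This applies to slices, whose
    tangent vectors are tangent to the source and do not move the fixed
    coefficients.

    _Coordinates._ Let [c_j] be the coefficient of [T^j]. The two equations for
    [t = x / p], cleared of denominators, are [sum_j c_j x^j p^(n-j) = 0] and
    [sum_j j c_j x^(j-1) p^(n-j) = p]. The second one, divided by [x], determines
    [y] modulo [x^(n-3)] as a polynomial in [x] and the lower coefficients, by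
    successive approximation: [y = h + x^(n-3) v], where modulo [x] the function
    [v] is a multiple of [c_(n-1)] ([y_coordinate]). Elimination of [c_(n-1)]
    gives similarly [z_3 = W + x^(n-3) w], where modulo [x] the function [w] is a
    multiple of [c_n] ([z_coordinate]). Then [x], the lower coefficients, [v] and
    [w] are the coordinates sought. Indeed, for [x = 0] the functions [c_2], ...,
    [c_n] are triangular in [y], [z_3], ..., [z_n] ([coefs_onto]); hence a
    polynomial in the new functions that is divisible by [x] is [x] times a
    polynomial in the new functions ([family_divX]). So the new functions are
    algebraically independent, and the subalgebra that they generate is closed
    under division by [x]; as it contains [y] and [z_3], and as the lower
    coefficients determine the other [z_j] with divisions by [x^2] only
    ([coordinates_in]), it contains everything. Fixing some of the new
    coordinates yields the slices. *)

Set Implicit Arguments.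
Unset Strict Implicit.
Unset Printing Implicit Defensive.

Import GRing.Theory Num.Theory.
Local Open Scope ring_scope.

(** * Polynomials in several variables over an algebraically closed field *)

Lemma mpoly_ring_ind (A : comNzRingType) (n : nat)
    (P : {mpoly A[n]} -> Prop) :
  (forall c, P c%:MP) -> (forall i, P 'X_i) ->
  (forall p q, P p -> P q -> P (p + q)) ->
  (forall p q, P p -> P q -> P (p * q)) ->
  forall p, P p.
Proof.
move=> PC PX PD PM p; rewrite [p]mpolyE.
apply: (big_ind P) => [||m _]; [exact: (PC 0)|exact: PD|].
rewrite -mul_mpolyC; apply: (PM) => //; rewrite mpolyXE_id.
apply: (big_ind P) => [||i _]; [exact: (PC 1)|exact: PM|].
elim: (m i) => [|k IHk]; first by rewrite expr0; exact: (PC 1).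
by rewrite exprS; apply: PM.
Qed.

Lemma mpoly_rmorph_ext (A S : comNzRingType) (n : nat)
    (f g : {rmorphism {mpoly A[n]} -> S}) :
  (forall c, f c%:MP = g c%:MP) -> (forall i, f 'X_i = g 'X_i) -> f =1 g.
Proof.
move=> eqC eqX p; elim/mpoly_ring_ind: p => // p q eqp eqq.
  by rewrite !rmorphD eqp eqq.
by rewrite !rmorphM eqp eqq.
Qed.

Section Vanishing.
Variable F : closedFieldType.

Lemma closed_poly_eq0 (p : {poly F}) : (forall a, p.[a] = 0) -> p = 0.
Proof.
move=> p0; apply/eqP; apply: contraT => /closed_nonrootP [a].
by rewrite /root p0 eqxx.
Qed.

(** The values of [muni] on the variables are what is needed to invert it, and
    to follow evaluations through it. *)
Lemma muni_X_widen (n : nat) (i : 'I_n) :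
  muni ('X_(widen_ord (leqnSn n) i) : {mpoly F[n.+1]}) = ('X_i)%:P.
Proof.
rewrite /muni mmapX mmap1U; case: splitP => [j eqj|j].
  by congr ('X__)%:P; apply/val_inj => /=; rewrite -eqj.
by rewrite ord1 /= addn0 => /eqP; rewrite ltn_eqF.
Qed.

Lemma muni_X_max (n : nat) : muni ('X_ord_max : {mpoly F[n.+1]}) = 'X.
Proof.
rewrite /muni mmapX mmap1U; case: splitP => // j /=.
by have := ltn_ord j; rewrite ltn_neqAle => /andP[/eqP neq _] /esym.
Qed.

(** Substituting the last variable for the indeterminate inverts [muni]. *)
Lemma muni_eq0 (n : nat) (p : {mpoly F[n.+1]}) : muni p = 0 -> p = 0.
Proof.
have comm : commr_rmorph (@mwiden n F) 'X_ord_max by move=> c; apply: mulrC.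
pose unpeel := horner_morph comm.
pose f : {rmorphism {mpoly F[n.+1]} -> {mpoly F[n.+1]}} := unpeel \o @muni n F.
have fK : f =1 idfun.
  apply: mpoly_rmorph_ext => [c|i] /=.
    by rewrite muniC /unpeel horner_morphC /=; exact: mwidenC.
  have [ltin|geni] := ltnP i n.
    have -> : i = widen_ord (leqnSn n) (Ordinal ltin) by apply: val_inj.
    by rewrite muni_X_widen /unpeel horner_morphC /= /mwiden mmapX mmap1U.
  have -> : i = ord_max.
    by apply/val_inj/anti_leq; rewrite geni -ltnS ltn_ord.
  by rewrite muni_X_max /unpeel horner_morphX.
by move=> p0; rewrite -[p]fK /= p0 /unpeel rmorph0.
Qed.

(** Induction on the number of variables: the coefficients of [muni p] vanish
    at every point because univariate polynomials with too many roots do. *)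
Lemma mpoly_vanish (n : nat) (p : {mpoly F[n]}) :
  (forall u : 'I_n -> F, p.@[u] = 0) -> p = 0.
Proof.
elim: n p => [|n IHn] p p0.
  have p_eval : p = (p.@[fun=> 0])%:MP.
    have ext := @mpoly_rmorph_ext _ _ _ idfun
      (@mpolyC 0 F \o meval (fun=> 0)).
    by rewrite -[LHS]/(idfun p) ext => [|c|[]] //=; rewrite mevalC.
  by rewrite p_eval p0 mpolyC0.
apply: muni_eq0; apply/polyP => k; rewrite coef0; apply: IHn => u.
rewrite -coef_map [map_poly _ _]closed_poly_eq0 ?coef0 // => a.
pose ua (i : 'I_n.+1) := if unlift ord_max i is Some j then u j else a.
rewrite -(p0 ua).
pose f : {rmorphism {mpoly F[n.+1]} -> F} :=
  horner_eval a \o map_poly (meval u) \o @muni n F.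
rewrite -[LHS]/(f p); apply: (@mpoly_rmorph_ext _ _ _ f (meval ua)) => [c|i] /=.
  by rewrite muniC map_polyC /horner_eval hornerC /= !mevalC.
rewrite mevalXU /ua /horner_eval; case: unliftP => [j ->|->].
  have -> : lift ord_max j = widen_ord (leqnSn n) j.
    by apply: val_inj; rewrite /= /bump leqNgt ltn_ord.
  by rewrite muni_X_widen map_polyC hornerC /= mevalXU.
by rewrite muni_X_max map_polyX hornerX.
Qed.

Lemma mpolyXU_neq0 (n : nat) (i : 'I_n) : 'X_i != 0 :> {mpoly F[n]}.
Proof.
apply/eqP => /(congr1 (meval (fun=> 1))); rewrite mevalXU meval0 => /eqP.
by rewrite oner_eq0.
Qed.
Lemma mpoly_nonvanish (n : nat) (p : {mpoly F[n]}) :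
  p != 0 -> exists u : 'I_n -> F, p.@[u] != 0.
Proof.
move=> p_neq0; apply: contrapT => none; case/eqP: p_neq0.
apply: mpoly_vanish => u; apply/eqP; apply: contraT => pu.
by case: none; exists u.
Qed.

Lemma mpoly_eq (n : nat) (p q : {mpoly F[n]}) :
  (forall u : 'I_n -> F, p.@[u] = q.@[u]) -> p = q.
Proof.
move=> eqpq; apply/eqP; rewrite -subr_eq0; apply/eqP.
by apply: mpoly_vanish => u; rewrite mevalB eqpq subrr.
Qed.

(** Restriction to the parametrised line [s |-> u + s v]. *)
Definition line (n : nat) (u v : 'I_n -> F) : {mpoly F[n]} -> {poly F} :=
  mmap (@polyC F) (fun i => (u i)%:P + v i *: 'X).

HB.instance Definition _ n (u v : 'I_n -> F) :=
  GRing.RMorphism.copy (line u v)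
    (mmap (@polyC F) (fun i => (u i)%:P + v i *: 'X)).

Lemma lineC n (u v : 'I_n -> F) c : line u v c%:MP = c%:P.
Proof. by rewrite /line mmapC. Qed.

Lemma lineX n (u v : 'I_n -> F) i : line u v 'X_i = (u i)%:P + v i *: 'X.
Proof. by rewrite /line mmapX mmap1U. Qed.

Lemma horner_line n (u v : 'I_n -> F) p s :
  (line u v p).[s] = p.@[fun i => u i + s * v i].
Proof.
apply: (@mpoly_rmorph_ext _ _ _ (horner_eval s \o line u v) (meval _)) => /=.
  by move=> c; rewrite lineC /horner_eval hornerC mevalC.
move=> i; rewrite lineX /horner_eval mevalXU.
by rewrite hornerD hornerC hornerZ hornerX mulrC.
Qed.

(** Both sides are derivations over the evaluation at [u], with the same values
    on constants and variables. *)
Lemma deriv_line n (u v : 'I_n -> F) p :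
  (line u v p)^`().[0] = \sum_i v i * p^`M(i).@[u].
Proof.
have at0 q : (line u v q).[0] = q.@[u].
  by rewrite horner_line; apply: meval_eq => i; rewrite mul0r addr0.
elim/mpoly_ring_ind: p => [c|i|p q IHp IHq|p q IHp IHq].
- rewrite lineC derivC horner0 big1 // => i _.
  by rewrite mderivC meval0 mulr0.
- rewrite lineX derivD derivC add0r derivZ derivX hornerZ hornerC mulr1.
  rewrite (bigD1 i) //= big1 ?addr0 => [|j neq_ji].
    rewrite mderivX mnm1E eqxx scale1r -{1}[U_(i)%MM]add0m addmK.
    by rewrite mpolyX0 meval1 mulr1.
  by rewrite mderivX mnm1E eq_sym (negPf neq_ji) scale0r meval0 mulr0.
- rewrite rmorphD derivD hornerD IHp IHq -big_split; apply: eq_bigr => i _ /=.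
  by rewrite mderivD mevalD mulrDr.
- rewrite rmorphM derivM hornerD !hornerM IHp IHq !at0 mulr_suml mulr_sumr.
  rewrite -big_split; apply: eq_bigr => i _ /=.
  by rewrite mderivM mevalD !mevalM mulrDr !mulrA; congr (_ + _); ring.
Qed.

(** The polynomials whose image is stationary at [0] form a subalgebra. *)
Lemma deriv_image_eq0 n (f : {rmorphism {mpoly F[n]} -> {poly F}}) :
  (forall c, f c%:MP = c%:P) -> (forall i, (f 'X_i)^`().[0] = 0) ->
  forall q, (f q)^`().[0] = 0.
Proof.
move=> fC fX; elim/mpoly_ring_ind => [c|i|p q p0 q0|p q p0 q0].
- by rewrite fC derivC horner0.
- exact: fX.
- by rewrite rmorphD derivD hornerD p0 q0 addr0.
- by rewrite rmorphM derivM hornerD !hornerM p0 q0 mul0r mulr0 addr0.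
Qed.

(** On every line through the origin such a polynomial restricts to a
    univariate polynomial without roots, that is, to a constant. *)
Lemma mpoly_unit_constant n (p : {mpoly F[n]}) :
  (forall u : 'I_n -> F, p.@[u] != 0) ->
  exists2 c : F, c != 0 & p = c%:MP.
Proof.
move=> p_neq0; exists (p.@[fun=> 0]) => //.
apply: mpoly_eq => u; rewrite mevalC.
have /size_poly1P [c _ pc] : size (line (fun=> 0) u p) == 1%N.
  apply: contraT => /closed_rootP [s]; rewrite /root horner_line.
  by rewrite (negPf (p_neq0 _)).
have at_s s : p.@[fun i => 0 + s * u i] = c.
  by rewrite -(horner_line (fun=> 0)) pc hornerC.
transitivity c; [rewrite -(at_s 1)|rewrite -(at_s 0)];
  by apply: meval_eq => i; rewrite add0r ?mul1r ?mul0r.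
Qed.

(** Every polynomial is a multiple of [X_i] plus its restriction to the
    hyperplane [X_i = 0], and the latter is zero by [mpoly_vanish]. *)
Lemma mpoly_divX n (i : 'I_n) (p : {mpoly F[n]}) :
  (forall u : 'I_n -> F, u i = 0 -> p.@[u] = 0) ->
  exists q : {mpoly F[n]}, p = 'X_i * q.
Proof.
pose face := [tuple if j == i then 0 else 'X_j : {mpoly F[n]} | j < n].
have split_face q : exists r, q = 'X_i * r + (q \mPo face).
  elim/mpoly_ring_ind: q => [c|j|q r [q' eqq] [r' eqr]|q r [q' eqq] [r' eqr]].
  - by exists 0; rewrite mulr0 add0r comp_mpolyC.
  - have [->|neq_ji] := eqVneq j i.
      by exists 1; rewrite comp_mpolyXU -tnth_nth tnth_mktuple eqxx mulr1 addr0.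
    exists 0; rewrite comp_mpolyXU -tnth_nth tnth_mktuple (negPf neq_ji).
    by rewrite mulr0 add0r.
  - exists (q' + r'); rewrite rmorphD {1}eqq {1}eqr mulrDr /=; ring.
  - exists (q' * r + (q \mPo face) * r'); rewrite rmorphM /=.
    transitivity (('X_i * q' + (q \mPo face)) * ('X_i * r' + (r \mPo face))).
      by rewrite -eqq -eqr.
    by rewrite [in X in _ = _ * (_ * X + _) + _]eqr; ring.
move=> p0; have [q eqp] := split_face p; exists q.
rewrite {1}eqp (_ : p \mPo face = 0) ?addr0 //.
apply: mpoly_vanish => u; rewrite comp_mpoly_meval p0 //.
by rewrite tnth_mktuple eqxx meval0.
Qed.
End Vanishing.

(** * The polynomial Phi over a commutative ring *)

(** [lin_poly] is [p T - x], [den_poly] is [1 - y T], and [phi_poly] is the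
    polynomial Phi over an arbitrary commutative ring: besides the coordinate
    ring of the source it is used at points, along lines, and in function
    fields. The parameter [h] stands for one half. *)
Section PhiPoly.
Variables (A : comNzRingType) (n : nat) (h x y : A) (z : nat -> A).

Definition lin_poly : {poly A} := (1 + x * y) *: 'X - x%:P.

Definition den_poly : {poly A} := 1 - y *: 'X.

Definition head_poly : {poly A} := den_poly ^+ n.-1 * lin_poly.

Definition quot_poly : {poly A} :=
  (n%:R * y) *: (y *: 'X + h%:P) + z 3 *: ((1 + x * y) *: 'X + (h * x)%:P)
  + \sum_(4 <= j < n.+1) z j *: 'X^(j - 2).

Definition phi_poly : {poly A} := head_poly + lin_poly ^+ 2 * quot_poly.

Lemma tail_coef (i : nat) :
  (\sum_(4 <= j < n.+1) z j *: 'X^(j - 2))`_i =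
  if (2 <= i <= n - 2)%N then z i.+2 else 0.
Proof.
rewrite coef_sum; under eq_bigr => j _ do rewrite coefZ coefXn.
case: ifP => ltin; last first.
  rewrite big_nat_cond big1 // => j /andP[/andP[j4 jn] _].
  have -> : (i == j - 2)%N = false by lia.
  by rewrite mulr0.
rewrite (bigD1_seq i.+2) ?iota_uniq ?mem_index_iota //=; last by lia.
rewrite subn2 eqxx mulr1 big_nat_cond big1 ?addr0 // => j.
move=> /andP[/andP[j4 jn] ji].
have -> : (i == j - 2)%N = false by lia.
by rewrite mulr0.
Qed.

Lemma quot_coef (i : nat) : (4 <= n)%N ->
  quot_poly`_i = if i is i'.+2 then if (i <= n - 2)%N then z i.+2 else 0
                 else if i is 1 then n%:R * y ^+ 2 + z 3 * (1 + x * y)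
                 else n%:R * y * h + z 3 * (h * x).
Proof.
move=> n4; rewrite /quot_poly !coefD !coefZ !coefD !coefZ !coefX !coefC.
rewrite tail_coef.
by case: i => [|[|i]] /=; ring.
Qed.

Lemma size_quot : (4 <= n)%N -> (size quot_poly <= n.-1)%N.
Proof.
move=> n4; apply/leq_sizeP => j; rewrite quot_coef //; case: j => [|[|j]]; try lia.
by case: leqP => //; lia.
Qed.

Lemma size_lin : (size lin_poly <= 2)%N.
Proof.
apply/leq_sizeP => j lt1j; rewrite coefB coefZ coefX coefC.
by case: j lt1j => [|[|j]] //=; rewrite mulr0 subr0.
Qed.

Lemma lin_neq0 : lin_poly != 0.
Proof.
apply/eqP => /polyP l0.
have /eqP := l0 0; rewrite /lin_poly coefB coefZ coefX coefC coef0 /=.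
rewrite mulr0 sub0r oppr_eq0 => /eqP x0.
have /eqP := l0 1; rewrite /lin_poly coefB coefZ coefX coefC coef0 /=.
by rewrite x0 mul0r addr0 mulr1 subr0 oner_eq0.
Qed.

Lemma size_gpow k : (size (den_poly ^+ k) <= k.+1)%N.
Proof.
have size_g : (size den_poly <= 2)%N.
  apply/leq_sizeP => j lt1j; rewrite coefB coefZ coefX coef1.
  by case: j lt1j => [|[|j]] //=; rewrite mulr0 subr0.
apply: leq_trans (size_poly_exp_leq _ _) _.
by rewrite ltnS -{2}[k]mul1n leq_mul2r; apply/orP; right; lia.
Qed.

Lemma size_head : (4 <= n)%N -> (size head_poly <= n.+1)%N.
Proof.
move=> n4; apply: leq_trans (size_polyMleq _ _) _.
by have := size_gpow n.-1; have := size_lin; lia.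
Qed.

Lemma size_phi : (4 <= n)%N -> (size phi_poly <= n.+1)%N.
Proof.
move=> n4; apply: leq_trans (size_polyD _ _) _.
rewrite geq_max size_head //=; apply: leq_trans (size_polyMleq _ _) _.
have := size_quot n4; have := size_poly_exp_leq lin_poly 2; have := size_lin.
by lia.
Qed.

Lemma gpow_coef01 k : (den_poly ^+ k)`_0 = 1 /\
  (den_poly ^+ k)`_1 = - (k%:R * y).
Proof.
elim: k => [|k [IH0 IH1]]; first by rewrite expr0 !coefC /= mul0r oppr0.
rewrite exprS {1 3}/den_poly !mulrBl !mul1r -scalerAl !coefB !coefZ !coefXM /=.
rewrite IH0 IH1.
by split; [rewrite mulr0 subr0|rewrite -[k.+1]addn1 natrD]; ring.
Qed.

Lemma gpow_coef_last k : (den_poly ^+ k)`_k = (- y) ^+ k.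
Proof.
elim: k => [|k IHk]; first by rewrite !expr0 coef1.
rewrite exprS {1}/den_poly mulrBl mul1r -scalerAl coefB coefZ coefXM /= IHk.
by rewrite (leq_sizeP _ _ (size_gpow k)) // exprS; ring.
Qed.

Lemma linM_coef (q : {poly A}) i :
  (lin_poly * q)`_i = (if i is i'.+1 then (1 + x * y) * q`_i' else 0) - x * q`_i.
Proof.
rewrite mulrBl -scalerAl coefB coefZ coefXM mul_polyC coefZ.
by case: i => [|i] //=; rewrite mulr0.
Qed.

Lemma phi_coef0 : (4 <= n)%N -> phi_poly`_0 =
  - (x - h * n%:R * x ^+ 2 * y - h * x ^+ 3 * z 3).
Proof.
move=> n4; have [g0 _] := gpow_coef01 n.-1.
rewrite coefD [lin_poly ^+ 2]expr2 -mulrA /head_poly [_ * lin_poly]mulrC.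
rewrite !linM_coef g0.
by rewrite !quot_coef //=; ring.
Qed.

(** The choice of the terms with coefficients [n y] and [z_3] serves precisely
    to normalise this coefficient. *)
Lemma phi_coef1 : (4 <= n)%N -> 2%:R * h = 1 -> phi_poly`_1 = 1.
Proof.
move=> n4 h2; have [g0 g1] := gpow_coef01 n.-1.
rewrite coefD [lin_poly ^+ 2]expr2 -mulrA /head_poly [_ * lin_poly]mulrC.
rewrite !linM_coef g0 g1.
rewrite !quot_coef //=.
have -> : n.-1%:R = n%:R - 1 :> A by rewrite -subn1 natrB //; lia.
apply/eqP; rewrite -subr_eq0; apply/eqP.
transitivity ((1 - 2%:R * h) * ((1 + x * y) * x * (n%:R * y + z 3 * x))).
  by ring.
by rewrite h2 subrr mul0r.
Qed.

(** Read in increasing order, this recovers the coefficients of the quotient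
    from those of the whole with no other division than by [x ^+ 2]. *)
Lemma phi_coef_rec_up j :
  x ^+ 2 * quot_poly`_j.+2 =
  phi_poly`_j.+2 - head_poly`_j.+2 - (1 + x * y) ^+ 2 * quot_poly`_j
  + 2%:R * (1 + x * y) * x * quot_poly`_j.+1.
Proof.
by rewrite [phi_poly`__]coefD [lin_poly ^+ 2]expr2 -mulrA !linM_coef; ring.
Qed.

End PhiPoly.

Lemma map_lin (A B : comNzRingType) (f : {rmorphism A -> B}) x y :
  map_poly f (lin_poly x y) = lin_poly (f x) (f y).
Proof.
by rewrite /lin_poly rmorphB /= map_polyC map_polyZ map_polyX rmorphD rmorphM
  rmorph1.
Qed.

Lemma map_head (A B : comNzRingType) (f : {rmorphism A -> B}) n x y :
  map_poly f (head_poly n x y) = head_poly n (f x) (f y).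
Proof.
by rewrite /head_poly /den_poly rmorphM rmorphXn /= map_lin rmorphB /= map_polyZ
  map_polyX rmorph1.
Qed.

Lemma map_quot (A B : comNzRingType) (f : {rmorphism A -> B}) n h x y z :
  map_poly f (quot_poly n h x y z) =
  quot_poly n (f h) (f x) (f y) (fun j => f (z j)).
Proof.
rewrite /quot_poly !rmorphD /= !map_polyZ !rmorphD /= !map_polyZ !map_polyX.
rewrite !map_polyC /= !rmorphM !rmorphD !rmorph_nat !rmorphM rmorph1.
congr (_ + _); rewrite rmorph_sum /=; apply: eq_bigr => j _.
by rewrite map_polyZ map_polyXn.
Qed.

Lemma map_phi (A B : comNzRingType) (f : {rmorphism A -> B}) n h x y z :
  map_poly f (phi_poly n h x y z) =
  phi_poly n (f h) (f x) (f y) (fun j => f (z j)).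
Proof.
by rewrite /phi_poly rmorphD rmorphM rmorphXn /= map_lin map_head map_quot.
Qed.

(** * The marked root *)

Section MarkedRoot.
Variables (F : fieldType) (n : nat) (h x y : F).
Hypotheses (n4 : (4 <= n)%N) (p_neq0 : 1 + x * y != 0).
Let p := 1 + x * y.

Lemma lin_root : (lin_poly x y).[x / p] = 0.
Proof.
rewrite /lin_poly hornerD hornerN hornerZ hornerX hornerC -/p mulrCA mulfV //.
by rewrite mulr1 subrr.
Qed.

Lemma den_root : (den_poly y).[x / p] = p^-1.
Proof.
rewrite /den_poly hornerD hornerN hornerZ hornerX hornerC /p.
by field.
Qed.

Lemma linE : lin_poly x y = p *: ('X - (x / p)%:P).
Proof.
by rewrite scalerBr -[p *: _%:P]mul_polyC -polyCM mulrCA mulfV // mulr1.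
Qed.

Lemma head_deriv_root : (head_poly n x y)^`().[x / p] = p^-1 ^+ (n - 2).
Proof.
have p0 : p != 0 := p_neq0.
rewrite /head_poly derivM hornerD !hornerM lin_root mulr0 add0r horner_exp den_root.
rewrite linE derivZ derivXsubC hornerZ hornerC mulr1.
rewrite (_ : n.-1 = (n - 2).+1); last by lia.
by rewrite exprSr mulfVK.
Qed.

Lemma head_root : (head_poly n x y).[x / p] = 0.
Proof. by rewrite /head_poly hornerM lin_root mulr0. Qed.

Variable z : nat -> F.

Lemma phi_root : (phi_poly n h x y z).[x / p] = 0.
Proof.
rewrite /phi_poly hornerD head_root hornerM horner_exp lin_root expr2.
by rewrite !mul0r addr0.
Qed.

Lemma phi_deriv_root : (phi_poly n h x y z)^`().[x / p] = p^-1 ^+ (n - 2).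
Proof.
rewrite /phi_poly derivD hornerD head_deriv_root derivM hornerD !hornerM.
rewrite deriv_exp hornerMn hornerM !horner_exp lin_root !expr0n /=.
by rewrite !(mul0r, mulr0, mul0rn, addr0).
Qed.

End MarkedRoot.

(** The conditions at [t] say that [f - head_poly] has a double root at [t], so
    that it is divisible by [lin_poly ^+ 2]; the normalised coefficient of [T]
    puts the quotient in the required form. *)
Lemma phi_poly_of_root (F : fieldType) (n : nat) (h t p : F) (f : {poly F}) :
  (4 <= n)%N -> 2%:R * h = 1 -> t != 0 -> p != 0 ->
  (size f <= n.+1)%N -> f`_1 = 1 -> root f t -> p ^+ (n - 2) * f^`().[t] = 1 ->
  exists y z, 1 + t * p * y = p /\ phi_poly n h (t * p) y z = f.
Proof.
move=> n4 h2 t_neq0 p_neq0 szf f1 /rootP ft f't.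
pose x := t * p; pose y := (p - 1) / x.
have x_neq0 : x != 0 by rewrite mulf_neq0.
have pE : 1 + x * y = p by rewrite /y mulrCA mulfV // mulr1 addrC subrK.
have tE : x / (1 + x * y) = t by rewrite pE /x mulfK.
have p0 : 1 + x * y != 0 by rewrite pE.
pose G := f - head_poly n x y.
have Gt : G.[t] = 0.
  by rewrite /G hornerD hornerN ft -tE head_root // subr0.
have G't : G^`().[t] = 0.
  rewrite /G derivB hornerD hornerN -[t in X in _ - X]tE head_deriv_root // pE.
  apply/eqP; rewrite subr_eq0; apply/eqP.
  apply: (mulfI (expf_neq0 (n - 2) p_neq0)); rewrite f't exprVn mulfV //.
  exact: expf_neq0.
have [Q1 GE] := factor_theorem _ _ (introT rootP Gt).
have [Q2 Q1E] : exists Q2, Q1 = Q2 * ('X - t%:P).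
  apply/factor_theorem/rootP; move: G't.
  by rewrite GE derivM hornerD !hornerM derivXsubC hornerXsubC subrr mulr0 add0r
    hornerC mulr1.
pose B := p^-1 ^+ 2 *: Q2.
have GB : G = lin_poly x y ^+ 2 * B.
  rewrite GE Q1E linE // tE pE exprZn -scalerAl -scalerAr scalerA.
  by rewrite -exprMn mulfV // expr1n scale1r; ring.
have szB : (size B <= n.-1)%N.
  have [->|B_neq0] := eqVneq B 0; first by rewrite size_poly0.
  have : (size G <= n.+1)%N.
    apply: leq_trans (size_polyD _ _) _; rewrite size_polyN geq_max szf.
    exact: size_head.
  have l0 := lin_neq0 x y.
  have sl : size (lin_poly x y) = 2%N.
    by rewrite linE // size_scale // size_XsubC.
  rewrite GB expr2 !size_mul ?mulf_neq0 // sl /= add0n => sz.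
  rewrite -(leq_add2l 2); apply: leq_trans sz _; lia.
(* [z_j] is read off the coefficient of [T ^ (j - 2)] of the quotient, except
   [z_3], whose coefficient also contains [n y ^ 2]; the constant coefficient
   is then correct because [f] has coefficient 1 at [T]. *)
pose z (j : nat) := if j == 3%N then (B`_1 - n%:R * y ^+ 2) / p else B`_(j - 2)%N.
exists y, z; split=> //.
suff -> : phi_poly n h x y z = head_poly n x y + lin_poly x y ^+ 2 * B.
  by rewrite -GB addrC subrK.
congr (_ + _ * _); apply/polyP => i; rewrite quot_coef // pE.
case: i => [|[|i]].
- have [g0 g1] := gpow_coef01 y n.-1.
  have : (head_poly n x y)`_1 + (lin_poly x y ^+ 2 * B)`_1 = 1.
    by rewrite -coefD -GB addrC subrK.
  rewrite [lin_poly x y ^+ 2]expr2 -mulrA /head_poly [_ * lin_poly x y]mulrC.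
  rewrite !linM_coef g0 g1 /= pE => B1E.
  have n1 : n.-1%:R = n%:R - 1 :> F.
    by rewrite -subn1 natrB //; lia.
  have two_neq0 : 2%:R != 0 :> F.
    by apply: contra_eq_neq h2 => ->; rewrite mul0r eq_sym oner_neq0.
  apply: (mulfI (mulf_neq0 (mulf_neq0 two_neq0 p_neq0) x_neq0)).
  transitivity (2%:R * h * x * (n%:R * y * p + x * (z 3 * p))); first by ring.
  rewrite h2 mul1r /z /= divfK // -{1}pE.
  transitivity (p + (n%:R - 1) * (x * y) + x ^+ 2 * B`_1 - 1).
    by rewrite -pE; ring.
  by rewrite -[X in _ - X = _]B1E n1; ring.
- by rewrite /z /= divfK //; ring.
- rewrite /z /= !subSS subn0; case: leqP => // lt.
  by rewrite (leq_sizeP _ _ szB) //; lia.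
Qed.

(** The roots are simple, so that there are as many of them as the degree. *)
Lemma separable_vanish (F : closedFieldType) (P Q : {poly F}) :
  P != 0 -> (forall a, root P a -> P^`().[a] != 0) ->
  (size Q < size P)%N -> (forall a, root P a -> root Q a) -> Q = 0.
Proof.
move=> P_neq0 simple szQ rQ.
have [r PE] := closed_field_poly_normal P.
have lc0 : lead_coef P != 0 by rewrite lead_coef_eq0.
have rootE a : root P a = (a \in r) by rewrite PE rootZ // root_prod_XsubC.
have r_uniq : uniq r.
  rewrite -separable_prod_XsubC.
  have : separable_poly P.
    rewrite unlock; apply/Pdiv.ClosedField.coprimepP => a /simple.
    by [].
  by rewrite {1}PE (eqp_separable (eqp_scale _ lc0)).
have szP : size P = (size r).+1 by rewrite PE size_scale // size_prod_XsubC.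
apply: (@roots_geq_poly_eq0 _ _ r) => //; last by rewrite -ltnS -szP.
by apply/allP => a ra; apply: rQ; rewrite rootE.
Qed.

(** * Injectivity on tangent vectors *)

Section Tangent.
Variables (F : fieldType) (n : nat).
Hypotheses (n4 : (4 <= n)%N) (char0 : [pchar F] =i pred0).

(** First-order terms in an auxiliary parameter, which is the indeterminate of
    [{poly F}]; the outer indeterminate of [{poly {poly F}}] is [T]. *)
Definition first_order (P : {poly {poly F}}) : {poly F} := (swapXY P)^`().[0].
Definition zeroth_order (P : {poly {poly F}}) : {poly F} := (swapXY P).[0].

Lemma first_orderE P i : (first_order P)`_i = (P`_i)^`().[0].
Proof. by rewrite /first_order !horner_coef0 !coef_deriv !coefMn coef_swapXY. Qed.

Lemma zeroth_orderE P i : (zeroth_order P)`_i = (P`_i).[0].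
Proof. by rewrite /zeroth_order !horner_coef0 coef_swapXY. Qed.

Lemma first_orderD P Q : first_order (P + Q) = first_order P + first_order Q.
Proof. by rewrite /first_order rmorphD derivD hornerD. Qed.

Lemma first_orderM P Q : first_order (P * Q) =
  first_order P * zeroth_order Q + zeroth_order P * first_order Q.
Proof. by rewrite /first_order /zeroth_order rmorphM derivM hornerD !hornerM. Qed.

Lemma first_orderX P k : first_order (P ^+ k) =
  k%:R * zeroth_order P ^+ k.-1 * first_order P.
Proof.
rewrite /first_order /zeroth_order rmorphXn deriv_exp hornerMn hornerM.
by rewrite horner_exp -mulr_natl; ring.
Qed.

Lemma zeroth_order_map P : zeroth_order P = map_poly (horner_eval 0) P.
Proof. by apply/polyP => i; rewrite zeroth_orderE coef_map. Qed.

Variables (h : F) (X Y : {poly F}) (Z : nat -> {poly F}).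
Hypothesis h2 : 2%:R * h = 1.
Let x := X.[0].
Let y := Y.[0].
Let x' := X^`().[0].
Let y' := Y^`().[0].
Let p := 1 + x * y.
Let Phi := phi_poly n h%:P X Y Z.
Let Q := quot_poly n h%:P X Y Z.
Hypothesis flat : first_order Phi = 0.

Let l := lin_poly x y.
Let g := den_poly y.
Let l' := (x' * y + x * y') *: 'X - x'%:P.
Let B := zeroth_order Q.
Let B' := first_order Q.

Lemma first_order_lin : first_order (lin_poly X Y) = l'.
Proof.
apply/polyP => i; rewrite first_orderE /lin_poly /l' !coefB !coefZ !coefX !coefC.
by case: i => [|[|i]] /=; rewrite !derivE !hornerE ?mulr0 ?subr0 /x' /y' /x /y
  ?mulr1 ?sub0r //; ring.
Qed.

Lemma first_order_den : first_order (den_poly Y) = - (y' *: 'X).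
Proof.
apply/polyP => i; rewrite first_orderE /den_poly coefB coefN !coefZ !coefX coef1.
by case: i => [|[|i]] /=; rewrite !derivE !hornerE ?mulr0 ?subr0 /y'
  ?mulr1 ?sub0r //; ring.
Qed.

Lemma first_order_phi :
  - (n.-1%:R * g ^+ n.-2 * (y' *: 'X) * l) + g ^+ n.-1 * l'
  + 2%:R * l * l' * B + l ^+ 2 * B' = 0.
Proof.
rewrite -flat /Phi /phi_poly /head_poly first_orderD !first_orderM !first_orderX.
rewrite first_order_lin first_order_den /B' /B -/Q.
rewrite !zeroth_order_map !rmorphXn /= map_lin /den_poly rmorphB rmorph1 /=.
rewrite map_polyZ map_polyX /= /horner_eval -/x -/y -/l -/(den_poly y) -/g.
by rewrite /=; ring.
Qed.

Lemma quot_first_order_coef i : B'`_i =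
  if i is i'.+2 then if (i <= n - 2)%N then (Z i.+2)^`().[0] else 0
  else if i is 1 then n%:R * 2%:R * y * y' + (Z 3)^`().[0] * p
                      + (Z 3).[0] * (x' * y + x * y')
  else n%:R * h * y' + (Z 3)^`().[0] * (h * x) + (Z 3).[0] * (h * x').
Proof.
rewrite /B' first_orderE quot_coef // -polyC_natr.
case: i => [|[|i]].
- rewrite !(derivD, derivM, derivC, derivX, hornerD, hornerM, hornerC, horner0).
  by rewrite /x /x' /y'; ring.
- rewrite expr2 !(derivD, derivM, derivC, hornerD, hornerM, hornerC, horner0).
  by rewrite /p /x /x' /y /y'; ring.
by case: ifP => // _; rewrite derivC horner0.
Qed.

Lemma natF_neq0 k : (0 < k)%N -> k%:R != 0 :> F.
Proof. by rewrite lt0n (proj1 (pcharf0P F) char0). Qed.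

(** Once [x] and [y] are stationary, the first-order variation of the whole is
    [l^2] times that of the quotient. *)
Lemma tangent_last : x' = 0 -> y' = 0 ->
  forall j, (3 <= j <= n)%N -> (Z j)^`().[0] = 0.
Proof.
move=> x'0 y'0; have := first_order_phi.
rewrite /l' x'0 y'0 !(mul0r, mulr0, scale0r, addr0, add0r, subr0, oppr0, polyC0).
have l_neq0 : l != 0 := lin_neq0 x y.
move/eqP; rewrite mulf_eq0 expf_eq0 (negPf l_neq0) /= => /eqP B'0.
have z3 : (Z 3)^`().[0] = 0.
  have := quot_first_order_coef 0; have := quot_first_order_coef 1.
  rewrite B'0 !coef0 x'0 y'0 !(mulr0, mul0r, addr0, add0r).
  move=> zp zhx.
  have zx : (Z 3)^`().[0] * x = 0.
    rewrite -[LHS]mul1r -h2.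
    transitivity (2%:R * ((Z 3)^`().[0] * (h * x))); first by ring.
    by rewrite -zhx mulr0.
  rewrite -[LHS]mulr1 (_ : 1 = p - x * y); last by rewrite /p; ring.
  by rewrite mulrBr -zp mulrA zx mul0r subr0.
move=> j /andP[]; rewrite leq_eqVlt => /orP[/eqP <- //|lt3j lejn].
have := quot_first_order_coef (j - 2); rewrite B'0 coef0.
case: j lt3j lejn => [|[|[|[|j]]]] // _ lejn.
by rewrite !subSS subn0 ifT //; lia.
Qed.

(** Modulo [l] the vanishing of the variation gives [x' = x^2 y'], whence
    [l' = x y' l]. After a division by [l], reduction modulo [l] gives
    [x y' = 0]; what remains is [B' = (n - 1) y' g^(n - 2)], whose constant term
    forces [y' = 0]. When [p = 0] the polynomial [l] is a constant and reduction
    modulo [l] says nothing; the two highest coefficients in [T] are used. *)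
Lemma tangent_stationary : x' = 0 /\ y' = 0.
Proof.
have E := first_order_phi.
have n2 : (n - 2)%:R != 0 :> F by apply: natF_neq0; lia.
have n1E : n.-1%:R = (n - 2)%:R + 1 :> F.
  by rewrite natr1; congr _%:R; lia.
have [p0|p_neq0] := eqVneq p 0.
  have xy : x * y = -1 by rewrite -[x * y](addKr 1) -/p p0 addr0.
  have x_neq0 : x != 0.
    by apply: contra_eq_neq xy => ->; rewrite mul0r eq_sym oppr_eq0 oner_eq0.
  have y_neq0 : y != 0.
    by apply: contra_eq_neq xy => ->; rewrite mulr0 eq_sym oppr_eq0 oner_eq0.
  have szB : (size B <= n.-1)%N.
    by rewrite /B zeroth_order_map map_quot; apply: size_quot.
  have B'big i : (n - 2 < i)%N -> B'`_i = 0.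
    rewrite quot_first_order_coef; case: i => [|[|i]]; try lia.
    by rewrite ltnNge => /negPf ->.
  have lE : l = - x%:P by rewrite /l /lin_poly -/p p0 scale0r sub0r.
  have Ecoef k : (n.-1%:R * x * y') * (g ^+ n.-2)`_k
     + (x' * y + x * y') * (g ^+ n.-1)`_k - x' * (g ^+ n.-1)`_k.+1
     - 2%:R * x * ((x' * y + x * y') * B`_k - x' * B`_k.+1)
     + x ^+ 2 * B'`_k.+1 = 0.
    have E' : (n.-1%:R * x * y') *: (g ^+ n.-2 * 'X)
        + (x' * y + x * y') *: (g ^+ n.-1 * 'X) - x' *: g ^+ n.-1
        - (2%:R * x) *: ((x' * y + x * y') *: (B * 'X) - x' *: B)
        + x ^+ 2 *: B' = 0.
      by rewrite -[RHS]E lE /l' -!mul_polyC; ring.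
    move/(congr1 (fun q : {poly F} => q`_k.+1)): E'.
    by rewrite !(coefD, coefN, coefZ, coefMX, coef0) /=.
  have B_0 i : (n.-1 <= i)%N -> B`_i = 0 by move=> le; rewrite (leq_sizeP _ _ szB).
  have g_0 k i : (k < i)%N -> (g ^+ k)`_i = 0.
    by move=> lt; rewrite (leq_sizeP _ _ (size_gpow y k)).
  (* The coefficient of [T ^ n], then that of [T ^ (n - 1)]. *)
  have p'0 : x' * y + x * y' = 0.
    have := Ecoef n.-1; rewrite (g_0 n.-2) ?(g_0 n.-1 n.-1.+1) ?B_0 ?B'big; try lia.
    rewrite gpow_coef_last !(mulr0, subr0, addr0, add0r) => /eqP.
    by rewrite mulf_eq0 expf_eq0 oppr_eq0 (negPf y_neq0) andbF orbF => /eqP.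
  have := Ecoef n.-2; rewrite p'0 !(mul0r, addr0, sub0r) B'big; try lia.
  rewrite (_ : n.-2.+1 = n.-1); last by lia.
  rewrite B_0 ?gpow_coef_last // !(mulr0, oppr0, addr0).
  have x'y : x' * y = - (x * y') by apply/eqP; rewrite -addr_eq0 p'0.
  have -> : (- y) ^+ n.-1 = (- y) ^+ n.-2 * - y.
    by rewrite -exprSr; congr (_ ^+ _); lia.
  move=> top; have {top} : (- y) ^+ n.-2 * ((n - 2)%:R * (x * y')) = 0.
    transitivity (n.-1%:R * x * y' * (- y) ^+ n.-2 - x' * ((- y) ^+ n.-2 * - y)
      - (- y) ^+ n.-2 * (x' * y + x * y')); first by rewrite n1E; ring.
    by rewrite top p'0 mulr0 subr0.
  move/eqP; rewrite !mulf_eq0 expf_eq0 oppr_eq0 (negPf y_neq0) andbF.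
  rewrite (negPf n2) (negPf x_neq0) /= => /eqP y'0; split=> //.
  by move/eqP: x'y; rewrite y'0 mulr0 oppr0 mulf_eq0 (negPf y_neq0) orbF => /eqP.
have l_t : l.[x / p] = 0 := lin_root p_neq0.
have g_t : g.[x / p] = p^-1 := den_root p_neq0.
have l_neq0 : l != 0 := lin_neq0 x y.
(* Evaluation at [x / p], the root of [l], is reduction modulo [l]. *)
have x'E : x' = x ^+ 2 * y'.
  have l'_t : l'.[x / p] = 0.
    have := congr1 (horner^~ (x / p)) E; rewrite horner0.
    rewrite (_ : _ + _ = g ^+ n.-1 * l' + l * (l * B' + 2%:R * l' * B
      - n.-1%:R * g ^+ n.-2 * (y' *: 'X))); last by ring.
    rewrite hornerD [X in _ + X]hornerM l_t mul0r addr0 hornerM horner_exp g_t.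
    by move/eqP; rewrite mulf_eq0 expf_eq0 invr_eq0 (negPf p_neq0) andbF => /eqP.
  move: l'_t; rewrite /l' hornerD hornerN hornerZ hornerX hornerC => /eqP.
  rewrite subr_eq0 => /eqP tE.
  have -> : x' = x' * p - x' * x * y by rewrite /p; ring.
  by rewrite -{1}tE; field.
have l'E : l' = (x * y') *: l.
  rewrite /l' x'E /l /lin_poly scalerBr !scalerA -mul_polyC -[x * y' *: _]mul_polyC.
  rewrite -!mul_polyC /p; ring.
have E1 : n.-1%:R * g ^+ n.-2 * - (y' *: 'X) + (x * y') *: g ^+ n.-1
    + (2%:R * x * y') *: l * B + l * B' = 0.
  by apply: (mulfI l_neq0); rewrite mulr0 -[RHS]E l'E -!mul_polyC; ring.
have xy'0 : x * y' = 0.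
  have := congr1 (horner^~ (x / p)) E1; rewrite horner0.
  rewrite (_ : _ + _ = g ^+ n.-2 * (- (n.-1%:R * y')%:P * 'X + (x * y')%:P * g)
      + l * ((2%:R * x * y')%:P * B + B')); last first.
    rewrite (_ : n.-1 = n.-2.+1); last by lia.
    by rewrite exprS -!mul_polyC; ring.
  rewrite hornerD [X in _ + X]hornerM l_t mul0r addr0 hornerM horner_exp g_t.
  rewrite hornerD !hornerM hornerN !hornerC hornerX g_t => /eqP.
  rewrite mulf_eq0 expf_eq0 invr_eq0 (negPf p_neq0) andbF /= => /eqP tE.
  have /eqP : (n - 2)%:R * (x * y') * p^-1 = 0.
    by rewrite -[RHS]oppr0 -tE n1E; ring.
  by rewrite !mulf_eq0 (negPf n2) invr_eq0 (negPf p_neq0) orbF -mulf_eq0 => /eqP.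
have x'0 : x' = 0 by rewrite x'E expr2 -mulrA xy'0 mulr0.
split=> //.
have B'E : B' = (n.-1%:R * y') *: g ^+ n.-2.
  apply: (mulfI l_neq0); apply/eqP; rewrite -subr_eq0; apply/eqP.
  (* [T = l + x g], and [x y' = 0]. *)
  have yl : y' *: 'X = y' *: l :> {poly F}.
    transitivity (y' *: l + (x * y') *: g); last by rewrite xy'0 scale0r addr0.
    rewrite /l /g /lin_poly /den_poly -!mul_polyC; ring.
  move: E1; rewrite yl -[2%:R * x * y']mulrA xy'0 mulr0 !scale0r mul0r !addr0.
  by rewrite -!mul_polyC => {1}<-; ring.
have := quot_first_order_coef 0; rewrite B'E coefZ x'0.
have [-> _] := gpow_coef01 y n.-2; rewrite !(mulr0, mulr1, addr0) => zE.
have : (n - 2)%:R * y' ^+ 2 = 0.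
  transitivity (2%:R * ((n.-1%:R * y') * y') - 2%:R * h * n%:R * y' ^+ 2).
    rewrite h2 n1E (_ : n = n - 2 + 2)%N; last by lia.
    by rewrite [in RHS]natrD addnK; ring.
  rewrite zE; transitivity (2%:R * h * (Z 3)^`().[0] * (x * y')); first by ring.
  by rewrite xy'0 mulr0.
by move/eqP; rewrite mulf_eq0 (negPf n2) expf_eq0 /= => /eqP.
Qed.

End Tangent.

(** * The Keller property of slices *)

Section SliceMap.
Variables (R : realType) (n : nat).
Local Notation C := R[i].
Hypothesis n4 : (4 <= n)%N.

Definition half : C := 2%:R^-1.

Lemma two_half : 2%:R * half = 1.
Proof. by rewrite /half mulfV // pnatr_eq0. Qed.

Lemma coordinate_ord (i : 'I_n) : coordinate R n i = 'X_i.
Proof. by rewrite /coordinate valK. Qed.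

Lemma PhiE : Phi R n = phi_poly n half%:MP (xc R n) (yc R n) (zc R n).
Proof. by []. Qed.

Lemma map_PhiE (A : comNzRingType) (f : {rmorphism {mpoly C[n]} -> A}) :
  map_poly f (Phi R n) = phi_poly n (f half%:MP) (f (xc R n)) (f (yc R n))
    (fun j => f (zc R n j)).
Proof. by rewrite PhiE map_phi. Qed.

Lemma coefT_morph (A : comNzRingType) (f : {rmorphism {mpoly C[n]} -> A}) j :
  f (coefT R n j) = (phi_poly n (f half%:MP) (f (xc R n)) (f (yc R n))
    (fun j => f (zc R n j)))`_j.
Proof. by rewrite -map_PhiE coef_map. Qed.

Lemma coefT1 : coefT R n 1 = 1.
Proof.
rewrite /coefT PhiE phi_coef1 //.
by rewrite -(mpolyC_nat n R[i] 2) -mpolyCM two_half.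
Qed.

Lemma coefT_big j : (n < j)%N -> coefT R n j = 0.
Proof.
by move=> ltnj; rewrite /coefT PhiE (leq_sizeP _ _ (size_phi _ _ _ _ n4)).
Qed.

Lemma coefT0 : coefT R n 0 = - A0 R n.
Proof. by rewrite /A0 opprK. Qed.

Variables (k d : nat) (lam : nat -> C).
Variables (phi : n.-tuple {mpoly C[d]}) (psi : d.-tuple {mpoly C[n]}).
Variable F : d.-tuple {mpoly C[d]}.
Hypotheses (k1 : (1 <= k)%N) (kn : (k <= n - 2)%N) (dE : d = (n - k + 1)%N).
Hypothesis psi_phi : forall i, tnth psi i \mPo phi = 'X_i.
Hypothesis lowerE : forall j, (2 <= j <= k)%N -> coefT R n j \mPo phi = (lam j)%:MP.
Hypothesis FE : forall i : 'I_d, tnth F i =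
  (if (i < n - k)%N then coefT R n (k + 1 + i) else A0 R n) \mPo phi.

(** A vector in the kernel of the Jacobian matrix at [u] is the direction of a
    line along which all the coefficients of Phi are stationary. Then so are
    the coordinates of the source, by [tangent_stationary] and [tangent_last],
    and so are those of the slice, since they are polynomials in the former. *)
Lemma keller_slice : keller F.
Proof.
suff det_neq0 (u : 'I_d -> C) : (\det (jacobian F)).@[u] != 0.
  by have [c c_neq0 detE] := mpoly_unit_constant det_neq0; exists c.
rewrite -det_map_mx -det_tr; apply/negP => /det0P [v v_neq0 vJ].
case/eqP: v_neq0.
pose L := line u (v 0).
pose f : {rmorphism {mpoly C[n]} -> {poly C}} := L \o comp_mpoly phi.
have LF i : (L (tnth F i))^`().[0] = 0.
  rewrite deriv_line; have /rowP/(_ i) := vJ; rewrite !mxE => vJi.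
  by rewrite -[RHS]vJi; apply: eq_bigr => j _; rewrite !mxE.
have f_coef j : (f (coefT R n j))^`().[0] = 0.
  have [le1j|] := ltnP 1 j; last first.
    case: j => [|[|j]] // _; last first.
      by rewrite coefT1 rmorph1 derivC horner0.
    rewrite coefT0 rmorphN derivN hornerN.
    have lt : (n - k < d)%N by lia.
    have := LF (Ordinal lt); rewrite FE /= ltnn => ->.
    by rewrite oppr0.
  have [lejk|ltkj] := leqP j k.
    by rewrite /= lowerE ?le1j // /L lineC derivC horner0.
  have [lejn|ltnj] := leqP j n; last by rewrite coefT_big // rmorph0 deriv0 horner0.
  have lt : (j - k - 1 < d)%N by lia.
  have := LF (Ordinal lt); rewrite FE /= ifT; last by lia.
  by rewrite (_ : k + 1 + _ = j)%N //; lia.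
have fC c : f c%:MP = c%:P by rewrite [LHS]/= comp_mpolyC /L lineC.
have flat : first_order (phi_poly n half%:P (f (xc R n)) (f (yc R n))
    (fun j => f (zc R n j))) = 0.
  apply/polyP => j; have := f_coef j; rewrite coefT_morph fC.
  by rewrite first_orderE coef0.
have char0 := pchar_num C.
have [x0 y0] := tangent_stationary n4 char0 two_half flat.
have z0 := tangent_last n4 two_half flat x0 y0.
have fX (i : 'I_n) : (f 'X_i)^`().[0] = 0.
  rewrite -coordinate_ord; case: i => [[|[|i]] lt].
  - exact: x0.
  - exact: y0.
  - apply: (z0 i.+3); exact: lt.
have f0 := deriv_image_eq0 fC fX.
apply/rowP => i; rewrite mxE; have := f0 (tnth psi i); rewrite /= psi_phi /L lineX.
by rewrite derivD derivC add0r derivZ derivX hornerZ hornerC mulr1.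
Qed.

End SliceMap.

(** * Degrees of field extensions with an explicit basis *)

Section ExtensionDegree.
Variables (D : idomainType) (K : fieldType) (iota : {rmorphism D -> K}).

Definition fractions_of (f : K) : Prop :=
  exists g h, iota h != 0 /\ f = iota g / iota h.

Variables (N : nat) (e : 'I_N -> K).

Definition lspan (f : K) : Prop :=
  exists2 c : 'I_N -> K, forall i, fractions_of (c i) & f = \sum_i c i * e i.

Lemma fractions_of_iota g : fractions_of (iota g).
Proof. by exists g, 1; rewrite rmorph1 oner_neq0 divr1. Qed.

Lemma fractions_ofD f g : fractions_of f -> fractions_of g -> fractions_of (f + g).
Proof.
move=> [a [b [b0 ->]]] [c [d [d0 ->]]]; exists (a * d + c * b), (b * d).
by rewrite rmorphD !rmorphM mulf_neq0 // addf_div.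
Qed.

Lemma fractions_ofM f g : fractions_of f -> fractions_of g -> fractions_of (f * g).
Proof.
move=> [a [b [b0 ->]]] [c [d [d0 ->]]]; exists (a * c), (b * d).
by rewrite !rmorphM mulf_neq0 // mulf_div.
Qed.

Lemma fractions_ofV f : fractions_of f -> fractions_of f^-1.
Proof.
move=> [a [b [b0 ->]]]; have [a0|a0] := eqVneq (iota a) 0.
  by rewrite a0 mul0r invr0 -(rmorph0 iota); apply: fractions_of_iota.
by exists b, a; rewrite invf_div.
Qed.

(** Clearing denominators brings linear algebra over the field of fractions
    back to linear algebra over [D]. *)
Lemma common_denominator (I : finType) (c : I -> K) :
  (forall i, fractions_of (c i)) ->
  exists (g : I -> D) (h : D), iota h != 0 /\ forall i, c i * iota h = iota (g i).
Proof.
move=> /choice [num /choice [den numden]].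
exists (fun i => num i * \prod_(j | j != i) den j), (\prod_j den j).
split=> [|i].
  by rewrite rmorph_prod; apply/prodf_neq0 => i _; have [] := numden i.
have [den0 ->] := numden i.
by rewrite [in LHS](bigD1 i) //= !rmorphM mulrA divfK.
Qed.

Lemma lspanD f g : lspan f -> lspan g -> lspan (f + g).
Proof.
move=> [a aL ->] [b bL ->]; exists (fun i => a i + b i).
  by move=> i; apply: fractions_ofD.
by rewrite -big_split; apply: eq_bigr => i _ /=; rewrite mulrDl.
Qed.

Lemma lspanZ a f : fractions_of a -> lspan f -> lspan (a * f).
Proof.
move=> aL [b bL ->]; exists (fun i => a * b i) => [i|].
  exact: fractions_ofM.
by rewrite mulr_sumr; apply: eq_bigr => i _; rewrite mulrA.
Qed.

Lemma lspan0 : lspan 0.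
Proof.
exists (fun=> 0) => [_|]; first by rewrite -(rmorph0 iota); apply: fractions_of_iota.
by rewrite big1 // => i _; rewrite mul0r.
Qed.

Lemma lspan_sum (I : Type) (r : seq I) (P : pred I) (f : I -> K) :
  (forall i, P i -> lspan (f i)) -> lspan (\sum_(i <- r | P i) f i).
Proof. by apply: big_ind; [apply: lspan0|apply: lspanD]. Qed.

Lemma lspan_basis i : lspan (e i).
Proof.
exists (fun j => iota (j == i)%:R) => [j|]; first exact: fractions_of_iota.
rewrite (bigD1 i) //= eqxx rmorph1 mul1r big1 ?addr0 // => j /negPf ->.
by rewrite rmorph0 mul0r.
Qed.

Hypothesis indep : forall c : 'I_N -> D,
  \sum_i iota (c i) * e i = 0 -> forall i, c i = 0.
Hypothesis lspan1 : lspan 1.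
Hypothesis lspan_mulb : forall i j, lspan (e i * e j).

Lemma lspanM f g : lspan f -> lspan g -> lspan (f * g).
Proof.
move=> [a aL ->] [b bL ->]; rewrite mulr_suml; apply: lspan_sum => i _.
rewrite mulr_sumr; apply: lspan_sum => j _.
by rewrite mulrACA; apply: lspanZ; [apply: fractions_ofM|].
Qed.

(** Multiplication by [f] has, in the family [e], a matrix [a / h] with [a]
    over [D]. Its determinant does not vanish because [e] is independent, and
    the adjugate matrix then expresses [1 / f]. *)
Lemma lspanV f : lspan f -> lspan f^-1.
Proof.
move=> fS; have [->|f_neq0] := eqVneq f 0; first by rewrite invr0; apply: lspan0.
have /choice [c cP] : forall i, exists c : 'I_N -> K,
    (forall j, fractions_of (c j)) /\ f * e i = \sum_j c j * e j.
  by move=> i; have [c cL fe] := lspanM fS (lspan_basis i); exists c.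
have [|a [h [h_neq0 aE]]] :=
  @common_denominator ('I_N * 'I_N)%type (fun ij => c ij.1 ij.2).
  by move=> [i j]; have [] := cP i.
pose M := \matrix_(i < N, j < N) a (i, j).
have Me i : iota h * f * e i = \sum_j iota (M i j) * e j.
  rewrite -mulrA; have [_ ->] := cP i; rewrite mulr_sumr; apply: eq_bigr => j _.
  by rewrite mulrA mxE -aE [iota h * _]mulrC.
have det_neq0 : \det M != 0.
  apply/negP => /det0P [v v_neq0 vM]; case/eqP: v_neq0; apply/rowP => i.
  rewrite mxE; apply: (indep (c := v 0)).
  apply: (mulfI (mulf_neq0 h_neq0 f_neq0)); rewrite mulr0 mulr_sumr.
  under eq_bigr => j _ do rewrite mulrCA Me mulr_sumr.
  rewrite exchange_big big1 //= => j _.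
  under eq_bigr => l _ do rewrite mulrA -rmorphM.
  rewrite -mulr_suml -rmorph_sum; have /rowP/(_ j) := vM.
  by rewrite !mxE => ->; rewrite rmorph0 mul0r.
have adjE i : iota (\det M) * e i = iota h * f * \sum_j iota (\adj M i j) * e j.
  rewrite mulr_sumr; under eq_bigr => j _ do rewrite mulrCA Me mulr_sumr.
  rewrite exchange_big /=.
  transitivity (\sum_l iota ((\adj M *m M) i l) * e l).
    rewrite mul_adj_mx (bigD1 i) //= !mxE eqxx big1 ?addr0 // => l.
    by rewrite eq_sym !mxE => /negPf ->; rewrite rmorph0 mul0r.
  apply: eq_bigr => l _; rewrite mxE rmorph_sum mulr_suml.
  by apply: eq_bigr => j _; rewrite rmorphM mulrA.
have inv_e i : lspan (f^-1 * e i).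
  have det0 : iota (\det M) != 0.
    apply: contra_neq det_neq0 => det0; apply: (indep (c := fun=> \det M)) i.
    by rewrite big1 // => j _; rewrite det0 mul0r.
  have -> : f^-1 * e i =
      iota h / iota (\det M) * \sum_j iota (\adj M i j) * e j.
    apply: (mulfI (mulf_neq0 f_neq0 det0)).
    rewrite mulrACA mulfV // mul1r adjE; field.
    by rewrite det0.
  apply: lspanZ.
    apply: fractions_ofM; first exact: fractions_of_iota.
    by apply: fractions_ofV; apply: fractions_of_iota.
  apply: lspan_sum => j _; apply: lspanZ; first exact: fractions_of_iota.
  exact: lspan_basis.
have [c1 c1L oneE] := lspan1.
rewrite -[f^-1]mulr1 oneE mulr_sumr; apply: lspan_sum => i _.
by rewrite mulrCA; apply: lspanZ.
Qed.

Hypothesis lspan_num_den : forall f, exists a b, [/\ lspan a, lspan b & f = a / b].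

Lemma extension_degree_basis : extension_degree fractions_of N.
Proof.
exists e; split=> [f|c cL c0].
  have [a [b [aS bS ->]]] := lspan_num_den f.
  by have [c] := lspanM aS (lspanV bS); exists c.
have [g [h [h_neq0 gE]]] := common_denominator cL.
have g0 : forall i, g i = 0.
  apply: indep; transitivity (iota h * \sum_i c i * e i); last by rewrite c0 mulr0.
  by rewrite mulr_sumr; apply: eq_bigr => i _; rewrite -gE mulrA [iota h * _]mulrC.
by move=> i; apply: (mulIf h_neq0); rewrite gE g0 rmorph0 mul0r.
Qed.

End ExtensionDegree.

(** * Recovering the coordinates from the coefficients *)

Lemma phi_poly_eq (A : comNzRingType) (n : nat) (h x y : A) (z z' : nat -> A) :
  (4 <= n)%N -> (forall j, (3 <= j <= n)%N -> z j = z' j) ->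
  phi_poly n h x y z = phi_poly n h x y z'.
Proof.
move=> n4 eqz; congr (_ + _ * _); apply/polyP => i; rewrite !quot_coef //.
have lt3 : (3 <= 3 <= n)%N by lia.
case: i => [|[|i]]; rewrite ?(eqz _ lt3) //.
by case: ifP => // le; apply: eqz; lia.
Qed.

(** The set [S] is a subring closed under division by [x ^+ 2]; it will be a
    subfield of the function field, and a subalgebra of the coordinate ring. *)
Section Generated.
Variables (A : comNzRingType) (S : A -> Prop).
Hypotheses (S0 : S 0) (S1 : S 1).
Hypothesis SD : forall a b, S a -> S b -> S (a + b).
Hypothesis SN : forall a, S a -> S (- a).
Hypothesis SM : forall a b, S a -> S b -> S (a * b).

Definition coefs_in (q : {poly A}) := forall i, S q`_i.

Lemma coefs_inM q r : coefs_in q -> coefs_in r -> coefs_in (q * r).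
Proof. by move=> qS rS i; rewrite coefM; apply: big_ind => // j _; apply: SM. Qed.

Lemma coefs_inX q k : coefs_in q -> coefs_in (q ^+ k).
Proof.
move=> qS; elim: k => [|k IHk]; last by rewrite exprS; apply: coefs_inM.
by move=> i; rewrite expr0 coef1; case: (i == _).
Qed.

Variables (n : nat) (h x y : A) (z : nat -> A).
Hypothesis n4 : (4 <= n)%N.
Hypotheses (Sh : S h) (Sx : S x) (Sy : S y) (Sz3 : S (z 3)).
Hypothesis Sdiv : forall a, S (x ^+ 2 * a) -> S a.
Hypothesis Scoef : forall j, (2 <= j <= n - 2)%N -> S (phi_poly n h x y z)`_j.

Lemma closed_nat k : S k%:R.
Proof. by elim: k => // k IHk; rewrite -natr1; apply: SD. Qed.

Lemma head_coefs_in : coefs_in (head_poly n x y).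
Proof.
apply: coefs_inM => [|i].
  apply: coefs_inX => i; rewrite coefB coef1 coefZ coefX.
  by apply: SD; [|apply/SN/SM => //]; apply: closed_nat.
rewrite coefB coefZ coefX coefC.
apply: SD; first by apply: SM; [apply/SD => //; apply: SM|apply: closed_nat].
by apply: SN; case: ifP.
Qed.

(** By increasing index, through [phi_coef_rec_up]. *)
Lemma quot_coefs_in i : S (quot_poly n h x y z)`_i.
Proof.
elim/ltn_ind: i => i IHi.
have pS : S (1 + x * y) by apply: SD => //; apply: SM.
case: i IHi => [|[|i]] IHi.
- rewrite quot_coef //; apply: SD; apply: SM => //; try exact: SM.
  by apply: SM => //; apply: closed_nat.
- rewrite quot_coef //; apply: SD; apply: SM => //; try exact: closed_nat.
  exact: SM.
have [lt|le] := ltnP (n - 2) i.+2; first by rewrite quot_coef // leqNgt lt.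
apply: Sdiv; rewrite phi_coef_rec_up; apply: SD.
  apply: SD; first by apply: SD; [apply: Scoef; lia|apply/SN/head_coefs_in].
  by apply/SN/SM; [exact: SM|apply: IHi].
apply: SM; last exact: IHi.
by apply: SM => //; apply: SM => //; apply: closed_nat.
Qed.

Lemma coordinates_in j : (3 <= j <= n)%N -> S (z j).
Proof.
case/andP; rewrite leq_eqVlt => /orP[/eqP <- //|lt3j lejn].
have := quot_coefs_in (j - 2); rewrite quot_coef //.
case: j lt3j lejn => [|[|[|[|j]]]] // _ lejn.
by rewrite !subSS subn0 ifT //; lia.
Qed.

End Generated.

(** * The geometric degree of a slice *)

Definition tofrac_comp (A : comNzRingType) (D : idomainType)
    (f : {rmorphism A -> D}) : {rmorphism A -> {fraction D}} :=
  @FracField.tofrac D \o f.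

Lemma fraction_num_den (D : idomainType) (f : {fraction D}) :
  exists a b : D, f = tofrac a / tofrac b.
Proof.
elim/quotW: f => r; exists \n_r, \d_r.
unlock FracField.tofrac.
rewrite -[_^-1]FracField.pi_inv -[RHS]FracField.pi_mul.
rewrite /FracField.invf /FracField.mulf.
rewrite !numden_Ratio ?oner_neq0 ?denom_ratioP //.
by rewrite mulr1 mul1r Ratio_numden.
Qed.

Lemma coef_sum_ord (A : nzRingType) (l : nat) (c : 'I_l -> A) (b : 'I_l) :
  (\sum_(i < l) c i *: 'X^i)`_b = c b.
Proof.
rewrite coef_sum (bigD1 b) //= coefZ coefXn eqxx mulr1 big1 ?addr0 // => i.
by rewrite -val_eqE coefZ coefXn eq_sym => /negPf ->; rewrite mulr0.
Qed.

Lemma size_sum_ord (A : nzRingType) (l : nat) (c : 'I_l -> A) :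
  (size (\sum_(i < l) c i *: 'X^i)%R <= l)%N.
Proof.
apply: leq_trans (size_sum _ _ _) _; apply/bigmax_leqP => b _.
by apply: leq_trans (size_scale_leq _ _) _; rewrite size_polyXn.
Qed.

Lemma monomial_numeratorE (K : fieldType) (x p : K) (a b N : nat) : p != 0 ->
  x ^+ a * p ^+ N = p ^+ (N + a + b) * ((x / p) ^+ a * p^-1 ^+ b).
Proof.
move=> p0; have pa := expf_neq0 a p0; have pb := expf_neq0 b p0.
rewrite !exprD expr_div_n exprVn; field.
by rewrite pa pb.
Qed.

(** Reduction modulo the equations of degree [n] for [t] and of degree [m] for
    [w] over the field of [t]. *)
Lemma monomials_span (K : fieldType) (L S : K -> Prop) (n m : nat) (t w : K)
    (c : nat -> K) :
  (0 < m)%N ->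
  (forall a b, L a -> L b -> L (a * b)) -> (forall a, L a -> L (- a)) ->
  (forall a, L a -> L a^-1) -> (forall j, L j%:R) ->
  S 0 -> (forall a b, S a -> S b -> S (a + b)) ->
  (forall a b, L a -> S b -> S (a * b)) ->
  (forall a b, (a < n)%N -> (b < m)%N -> S (t ^+ a * w ^+ b)) ->
  (forall j, L (c j)) -> c n != 0 ->
  \sum_(j < n.+1) c j * t ^+ j = 0 ->
  w ^+ m = \sum_(j < n) j.+1%:R * c j.+1 * t ^+ j ->
  forall a b, S (t ^+ a * w ^+ b).
Proof.
move=> m0 LM LN LV Ln S0 SD SZ Ssmall Lc cn_neq0 trel wrel.
have tn : t ^+ n = \sum_(j < n) - (c n)^-1 * c j * t ^+ j.
  apply: (mulfI cn_neq0); apply/eqP; rewrite -subr_eq0; apply/eqP.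
  rewrite -[RHS]trel big_ord_recr /= addrC; congr (_ + _).
  rewrite mulr_sumr -sumrN; apply: eq_bigr => j _.
  by field.
have St a : forall b, (b < m)%N -> S (t ^+ a * w ^+ b).
  elim/ltn_ind: a => a IHa b ltbm.
  have [ltan|lena] := ltnP a n; first exact: Ssmall.
  rewrite -(subnK lena) exprD tn mulr_sumr mulr_suml.
  apply: big_ind => // j _.
  have -> : t ^+ (a - n) * (- (c n)^-1 * c j * t ^+ j) * w ^+ b =
      - (c n)^-1 * c j * (t ^+ (a - n + j) * w ^+ b) by rewrite exprD; ring.
  apply: (SZ); first by apply: (LM) => //; apply/LN/LV.
  by apply: IHa => //; have := ltn_ord j; lia.
move=> a b; elim/ltn_ind: b a => b IHb a.
have [ltbm|lemb] := ltnP b m; first exact: St.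
rewrite -(subnK lemb) exprD wrel mulrA mulr_sumr.
apply: big_ind => // j _.
have -> : t ^+ a * w ^+ (b - m) * (j.+1%:R * c j.+1 * t ^+ j) =
  j.+1%:R * c j.+1 * (t ^+ (a + j) * w ^+ (b - m)) by rewrite exprD; ring.
by apply: (SZ); [apply: (LM)|apply: IHb; lia].
Qed.

(** [x = (x w) / w], then [y] from [1 + x y = 1 / w], [z_3] from the constant
    coefficient, and the others by [coordinates_in]. *)
Lemma coordinates_rational (K : fieldType) (S : K -> Prop) (n : nat)
    (h x y w : K) (z : nat -> K) :
  (4 <= n)%N -> 2%:R * h = 1 ->
  S 0 -> S 1 -> (forall a b, S a -> S b -> S (a + b)) ->
  (forall a, S a -> S (- a)) ->
  (forall a b, S a -> S b -> S (a * b)) -> (forall a, S a -> S a^-1) ->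
  x != 0 -> 1 + x * y = w^-1 -> S h -> S (x * w) -> S w -> w != 0 ->
  (forall j, S (phi_poly n h x y z)`_j) ->
  [/\ S x, S y & forall j, (3 <= j <= n)%N -> S (z j)].
Proof.
move=> n4 h2 S0 S1 SD SN SM SV x_neq0 pE Sh St Sw w_neq0 Sc.
have h_neq0 : h != 0.
  by apply: contra_eq_neq h2 => ->; rewrite mulr0 eq_sym oner_neq0.
have Sx : S x by rewrite -(mulfK w_neq0 x); apply: (SM) => //; apply: (SV).
have Sy : S y.
  rewrite -(mulKf x_neq0 y); apply: (SM); first exact: SV.
  by rewrite -[x * y](addKr 1) pE; apply: (SD); [apply: (SN)|apply: (SV)].
have Snat k : S k%:R by elim: k => // k IHk; rewrite -natr1; apply: (SD).
have Sz3 : S (z 3).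
  have c0 := Sc 0; rewrite phi_coef0 // in c0.
  have x3 : h * x ^+ 3 != 0 by rewrite mulf_neq0 // expf_neq0.
  rewrite -(mulKf x3 (z 3)); apply: (SM).
    by apply/SV/SM => //; rewrite exprS expr2; do 2!apply: (SM) => //.
  set B := - _ in c0.
  have -> : h * x ^+ 3 * z 3 = B + x - h * n%:R * x ^+ 2 * y by rewrite /B; ring.
  apply: (SD); first exact: SD.
  by apply/SN/SM => //; apply: (SM); [apply: (SM)|rewrite expr2; apply: (SM)].
split=> //; apply: (coordinates_in S0 S1 SD SN SM n4 Sh Sx Sy Sz3) => // a Sa.
rewrite -(mulKf (expf_neq0 2 x_neq0) a); apply: (SM) => //.
by rewrite expr2; apply/SV/SM.
Qed.

Section SliceDegree.
Variables (R : realType) (n : nat).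
Local Notation C := R[i].
Hypothesis n4 : (4 <= n)%N.
Variables (k d : nat) (lam : nat -> C).
Variables (phi : n.-tuple {mpoly C[d]}) (psi : d.-tuple {mpoly C[n]}).
Variable F : d.-tuple {mpoly C[d]}.
Hypotheses (k1 : (1 <= k)%N) (kn : (k <= n - 2)%N) (dE : d = (n - k + 1)%N).
Hypothesis psi_phi : forall i, tnth psi i \mPo phi = 'X_i.
Hypothesis phi_psi : forall P : 'I_n -> C,
  (forall j, (2 <= j <= k)%N -> (coefT R n j).@[P] = lam j) ->
  forall i, (tnth phi i).@[fun l => (tnth psi l).@[P]] = P i.
Hypothesis lowerE : forall j, (2 <= j <= k)%N -> coefT R n j \mPo phi = (lam j)%:MP.
Hypothesis FE : forall i : 'I_d, tnth F i =
  (if (i < n - k)%N then coefT R n (k + 1 + i) else A0 R n) \mPo phi.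

Definition extend (A : zmodType) (v : 'I_d -> A) (i : nat) : A :=
  oapp v 0 (insub i).

Lemma extend_ord (A : zmodType) (v : 'I_d -> A) (i : 'I_d) : extend v i = v i.
Proof. by rewrite /extend valK. Qed.

(** The coefficient of [T ^ j]: it is fixed for [2 <= j <= k], the target
    coordinate of index [j - k - 1] for [j > k], and minus the last target
    coordinate, which is [A_0], for [j = 0]. *)
Definition target_coef (A : zmodType) (one : A) (lamA v : nat -> A) (j : nat) : A :=
  if j == 0%N then - v (n - k)%N else if j == 1%N then one
  else if (j <= k)%N then lamA j
  else if (j <= n)%N then v (j - k - 1)%N else 0.

Lemma coefT_slice j : coefT R n j \mPo phi =
  target_coef 1 (fun j => (lam j)%:MP) (extend (tnth F)) j.
Proof.
rewrite /target_coef; case: j => [|[|j]] /=.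
- rewrite coefT0 rmorphN; congr (- _).
  have lt : (n - k < d)%N by lia.
  by rewrite -[(n - k)%N]/(val (Ordinal lt)) extend_ord FE /= ltnn.
- by rewrite coefT1 // rmorph1.
have [lejk|ltkj] := leqP j.+2 k; first by rewrite lowerE.
have [lejn|ltnj] := leqP j.+2 n; last by rewrite coefT_big // rmorph0.
have lt : (j.+2 - k - 1 < d)%N by lia.
rewrite -[(j.+2 - k - 1)%N]/(val (Ordinal lt)) extend_ord FE /= ifT; last by lia.
by congr (coefT R n _ \mPo phi); lia.
Qed.

Definition target_poly (v : 'I_d -> C) : {poly C} :=
  \poly_(j < n.+1) target_coef 1 lam (extend v) j.

Lemma target_poly_coef v j : (target_poly v)`_j = target_coef 1 lam (extend v) j.
Proof.
rewrite coef_poly; case: leqP => // ltnj; rewrite /target_coef.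
by rewrite !ifF //; lia.
Qed.

Let xs : {mpoly C[d]} := xc R n \mPo phi.
Let ys : {mpoly C[d]} := yc R n \mPo phi.
Let ps : {mpoly C[d]} := 1 + xs * ys.

Lemma ps_eval u : ps.@[u] = 1 + xs.@[u] * ys.@[u].
Proof. by rewrite /ps mevalD meval1 mevalM. Qed.

(** The point of the source given by [phi_poly_of_root] has the prescribed lower
    coefficients, hence lies on the slice. *)
Lemma fibre_point v (t p : C) : t != 0 -> p != 0 -> root (target_poly v) t ->
  p ^+ (n - 2) * (target_poly v)^`().[t] = 1 ->
  exists u : 'I_d -> C,
    [/\ forall i, (tnth F i).@[u] = v i, xs.@[u] = t * p & ps.@[u] = p].
Proof.
move=> t_neq0 p_neq0 ft f't.
have f1 : (target_poly v)`_1 = 1 by rewrite target_poly_coef.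
have [y [z [pE phiE]]] :=
  phi_poly_of_root (f := target_poly v) n4 (two_half R) t_neq0 p_neq0
    (size_poly _ _) f1 ft f't.
pose P (i : 'I_n) : C :=
  if val i is i'.+1 then if i' is i''.+1 then z i.+1 else y else t * p.
have n0 : (0 < n)%N by lia.
have n1 : (1 < n)%N by lia.
have xP : (xc R n).@[P] = t * p.
  by rewrite /xc -[0%N]/(val (Ordinal n0)) coordinate_ord mevalXU.
have yP : (yc R n).@[P] = y.
  by rewrite /yc -[1%N]/(val (Ordinal n1)) coordinate_ord mevalXU.
have zP j : (3 <= j <= n)%N -> (zc R n j).@[P] = z j.
  case: j => [|[|[|j]]] // le.
  by rewrite /zc -[_.-1]/(val (Ordinal le)) coordinate_ord mevalXU.
have coefP j : (coefT R n j).@[P] = target_coef 1 lam (extend v) j.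
  rewrite (coefT_morph (meval P)) -target_poly_coef -phiE -[in RHS]xP -[in RHS]yP.
  rewrite -[in RHS](mevalC P (half R)).
  rewrite (@phi_poly_eq _ n _ _ _ (fun j => meval P (zc R n j)) z n4) //.
have phiP : forall i, (tnth phi i).@[fun l => (tnth psi l).@[P]] = P i.
  apply: phi_psi => j /andP[j2 jk]; rewrite coefP /target_coef.
  by rewrite jk; case: j j2 jk => [|[|j]].
have comp_u q : (q \mPo phi).@[fun l => (tnth psi l).@[P]] = q.@[P].
  by rewrite comp_mpoly_meval; apply: meval_eq.
have xu : xs.@[fun l => (tnth psi l).@[P]] = t * p by rewrite comp_u.
have yu : ys.@[fun l => (tnth psi l).@[P]] = y by rewrite comp_u.
exists (fun l => (tnth psi l).@[P]); split.
- move=> i; rewrite FE comp_u; case: ifP => lt.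
    rewrite coefP /target_coef ifF; last by lia.
    rewrite ifF; last by lia. rewrite ifF; last by lia.
    rewrite ifT; last by lia.
    by rewrite (_ : (_ - _ - _)%N = i) ?extend_ord //; lia.
  have -> : A0 R n = - coefT R n 0 by rewrite coefT0 opprK.
  rewrite mevalN coefP /target_coef /= opprK.
  rewrite (_ : (n - k)%N = i) ?extend_ord //.
  by have := ltn_ord i; lia.
- exact: xu.
- rewrite ps_eval -[RHS]pE; congr (1 + _ * _); [exact: xu|exact: yu].
Qed.

Lemma target_deriv0 v : (target_poly v)^`().[0] = 1.
Proof. by rewrite horner_coef0 coef_deriv target_poly_coef mulr1n. Qed.

Lemma size_target_poly v (top : (n - k - 1 < d)%N) :
  v (Ordinal top) != 0 -> size (target_poly v) = n.+1.
Proof.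
move=> v_neq0; apply: size_poly_eq; rewrite /target_coef.
rewrite ifF; last by lia.
rewrite ifF; last by lia.
rewrite ifF; last by lia.
by rewrite leqnn -[(n - k - 1)%N]/(val (Ordinal top)) extend_ord.
Qed.

(** Changing the last target coordinate only changes the constant term of
    [target_poly]; the finitely many values that create a multiple root are
    the critical values. *)
Lemma generic_target (g : {mpoly C[d]}) : g != 0 ->
  exists v : 'I_d -> C,
    [/\ g.@[v] != 0, size (target_poly v) = n.+1, (target_poly v).[0] != 0 &
        forall t, root (target_poly v) t -> (target_poly v)^`().[t] != 0].
Proof.
move=> g_neq0.
have top : (n - k - 1 < d)%N by lia.
have bot : (n - k < d)%N by lia.
have [v0] := mpoly_nonvanish (mulf_neq0 g_neq0 (mpolyXU_neq0 C (Ordinal top))).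
rewrite mevalM mevalXU mulf_eq0 negb_or => /andP[gv0 top_neq0].
pose dir (i : 'I_d) : C := (i == Ordinal bot)%:R.
pose v s (i : 'I_d) := v0 i + s * dir i.
pose f0 := target_poly v0.
have vE s : target_poly (v s) = f0 - s%:P.
  apply/polyP => j; rewrite coefB coefC !target_poly_coef /target_coef.
  have ext i : extend (v s) i = extend v0 i + s * (i == n - k)%N%:R.
    rewrite /extend; case: insubP => [l _ <-|] //=.
    rewrite -leqNgt => dlei; have -> : (i == n - k)%N = false by lia.
    by rewrite mulr0 addr0.
  rewrite !ext eqxx mulr1; case: eqP => [_|j0]; first by rewrite opprD.
  rewrite subr0; case: eqP => // j1; case: leqP => // ltkj; case: leqP => // lejn.
  have -> : (j - k - 1 == n - k)%N = false by lia.
  by rewrite mulr0 addr0.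
have [r critE] := closed_field_poly_normal f0^`().
pose W := line v0 dir g * ('X + (v0 (Ordinal bot))%:P)
  * \prod_(b <- [seq f0.[c] | c <- r]) ('X - b%:P).
have W_neq0 : W != 0.
  rewrite !mulf_neq0 //.
  - apply: contra_neq gv0 => /(congr1 (horner^~ 0)).
    rewrite horner_line horner0 => <-.
    by apply: meval_eq => i; rewrite mul0r addr0.
  - by rewrite -size_poly_eq0 size_XaddC.
  - by apply/monic_neq0/monic_prod => c _; apply: monicXsubC.
have [s] := elimT (closed_nonrootP _) W_neq0.
rewrite !rootM !negb_or root_prod_XsubC -/(v s) => /andP[/andP[gs bs] cs].
exists (v s); split.
- by move: gs; rewrite /root horner_line.
- apply: (size_target_poly (top := top)); rewrite /v /dir.
  have -> : (Ordinal top == Ordinal bot) = false by rewrite -val_eqE /=; lia.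
  by rewrite mulr0 addr0.
- rewrite horner_coef0 target_poly_coef /target_coef /= oppr_eq0.
  rewrite -[(n - k)%N]/(val (Ordinal bot)) extend_ord /v /dir eqxx mulr1.
  by move: bs; rewrite /root hornerD hornerX hornerC addrC.
- move=> t; rewrite vE /root hornerD hornerN hornerC subr_eq0 => /eqP f0t.
  rewrite derivB derivC subr0; apply: contra cs => crit_t.
  rewrite -f0t; apply: map_f.
  have crit_neq0 : lead_coef f0^`() != 0.
    rewrite lead_coef_eq0; apply/eqP => crit0.
    by have /eqP := target_deriv0 v0; rewrite -/f0 crit0 horner0 eq_sym oner_eq0.
  by move: crit_t; rewrite -/(root _ t) critE rootZ // root_prod_XsubC.
Qed.

Local Notation K := {fraction {mpoly C[d]}}.
Let m := (n - 2)%N.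
Let pullback : {rmorphism {mpoly C[d]} -> {mpoly C[d]}} := comp_mpoly F.
Let iota : {rmorphism {mpoly C[d]} -> K} := tofrac_comp pullback.
Let tK : K := FracField.tofrac xs / FracField.tofrac ps.
Let wK : K := (FracField.tofrac ps)^-1.

(** Over an algebraically closed field there are [t] and [p] as in
    [fibre_point] for every target as in [generic_target]. *)
Lemma dominant (g : {mpoly C[d]}) : g != 0 -> exists u : 'I_d -> C,
  [/\ (g \mPo F).@[u] != 0, xs.@[u] != 0 & ps.@[u] != 0].
Proof.
move=> /generic_target [v [gv szf f0 simple]].
have /closed_rootP [t ft] : size (target_poly v) != 1%N.
  by rewrite szf; lia.
have t_neq0 : t != 0 by apply: contraTneq ft => ->.
have der_neq0 := simple t ft; set der := _.[t] in der_neq0.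
have /closed_rootP [p] : size ('X^m - der^-1%:P) != 1%N.
  by rewrite size_XnsubC /m; lia.
rewrite /root hornerD hornerN hornerC hornerXn subr_eq0 => /eqP pE.
have p_neq0 : p != 0.
  apply: contraTneq (invr_neq0 der_neq0) => p0; rewrite -pE p0 expr0n.
  by rewrite (_ : (m == 0)%N = false) ?eqxx // /m; lia.
have pder : p ^+ m * der = 1 by rewrite pE mulVf.
have [u [Fu xu pu]] := fibre_point t_neq0 p_neq0 ft pder.
exists u; rewrite xu pu mulf_neq0 //; split=> //.
by rewrite comp_mpoly_meval (meval_eq _ Fu).
Qed.

Lemma comp_F_neq0 (g : {mpoly C[d]}) : g != 0 -> g \mPo F != 0.
Proof.
by move=> /dominant [u [gu _ _]]; apply: contra_neq gu => ->; rewrite meval0.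
Qed.

Lemma ps_neq0 : ps != 0.
Proof.
have [u [_ _ pu]] := dominant (oner_neq0 _).
by apply: contra_neq pu => ->; rewrite meval0.
Qed.

Lemma xs_neq0 : xs != 0.
Proof.
have [u [_ xu _]] := dominant (oner_neq0 _).
by apply: contra_neq xu => ->; rewrite meval0.
Qed.

Lemma monomial_numerator a b : (a < n)%N -> (b < m)%N ->
  FracField.tofrac (xs ^+ a * ps ^+ (n + m - a - b)) =
  FracField.tofrac ps ^+ (n + m) * (tK ^+ a * wK ^+ b).
Proof.
move=> ltan ltbm.
have p0 : FracField.tofrac ps != 0 by rewrite tofrac_eq0 ps_neq0.
rewrite rmorphM !rmorphXn (@monomial_numeratorE _ _ _ a b) //.
by congr (_ ^+ _ * _); lia.
Qed.

(** On the fibre over a general point the relation becomes, at each root [t], a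
    polynomial of degree less than [m] in [1 / p] with [m] roots, and then, for
    each power of [1 / p], a polynomial of degree less than [n] in [t] with [n]
    roots. *)
Lemma monomials_independent (g : 'I_n -> 'I_m -> {mpoly C[d]}) :
  \sum_a \sum_b iota (g a b) * (tK ^+ a * wK ^+ b) = 0 ->
  forall a b, g a b = 0.
Proof.
move=> sum0 a0 b0; apply/eqP; apply: contraT => /generic_target.
move=> [v [gv szf f0 simple]]; case/eqP: gv.
(* Multiplied by [p ^ (n + m)], the relation is one between polynomials, and
   can be evaluated. *)
have pol0 : \sum_a \sum_b (g a b \mPo F) * (xs ^+ a * ps ^+ (n + m - a - b)) = 0.
  apply/eqP; rewrite -(@tofrac_eq0 {mpoly C[d]}) rmorph_sum.
  apply/eqP; rewrite -[RHS](mulr0 (FracField.tofrac ps ^+ (n + m))).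
  rewrite -[X in _ * X]sum0.
  rewrite mulr_sumr; apply: eq_bigr => a _.
  rewrite rmorph_sum mulr_sumr; apply: eq_bigr => b _.
  rewrite [LHS](tofracM (g a b \mPo F)) monomial_numerator //; exact: mulrCA.
have m_neq0 : m%:R != 0 :> C by rewrite pnatr_eq0 /m; lia.
have at_root t : root (target_poly v) t -> forall b : 'I_m,
    \sum_a (g a b).@[v] * t ^+ a = 0.
  move=> ft; pose der := (target_poly v)^`().[t].
  have der_neq0 : der != 0 := simple t ft.
  have t_neq0 : t != 0.
    by apply: contraTneq ft => ->.
  pose Q : {poly C} :=
    \sum_(b < m) (\sum_a (g a b).@[v] * t ^+ a) *: 'X^b.
  suff Q0 : Q = 0.
    move=> b.
    rewrite -[LHS](coef_sum_ord (fun b => \sum_a (g a b).@[v] * t ^+ a) b).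
    by rewrite -/Q Q0 coef0.
  have szP : size ('X^m - der%:P) = m.+1 by rewrite size_XnsubC // /m; lia.
  apply: (@separable_vanish _ ('X^m - der%:P)).
  - by rewrite -size_poly_eq0 szP.
  - move=> w; rewrite /root derivB derivXn derivC subr0 hornerD hornerN hornerC.
    rewrite hornerXn hornerMn hornerXn subr_eq0 => /eqP wE.
    rewrite -mulr_natl mulf_neq0 // expf_neq0 //.
    apply: contra_neq der_neq0 => w0.
    by rewrite -wE w0 expr0n (_ : (m == 0)%N = false) //; lia.
  - by rewrite szP ltnS; apply: size_sum_ord.
  move=> w; rewrite /root hornerD hornerN hornerC hornerXn subr_eq0 => /eqP wE.
  have w_neq0 : w != 0.
    apply: contra_neq der_neq0 => w0; rewrite -wE w0 expr0n.
    by rewrite (_ : (m == 0)%N = false) // /m; lia.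
  have p_neq0 : w^-1 != 0 by rewrite invr_eq0.
  have pE : w^-1 ^+ m * der = 1 by rewrite -wE exprVn mulVf // expf_neq0.
  have [u [Fu xu pu]] := fibre_point t_neq0 p_neq0 ft pE.
  move/(congr1 (meval u)): pol0; rewrite meval0 => pol0.
  apply/eqP/(mulfI (expf_neq0 (n + m) p_neq0)); rewrite mulr0 -[RHS]pol0.
  rewrite horner_sum mulr_sumr.
  under eq_bigr => b _ do rewrite hornerZ hornerXn mulr_suml mulr_sumr.
  rewrite exchange_big raddf_sum; apply: eq_bigr => a _.
  rewrite raddf_sum; apply: eq_bigr => b _ /=.
  rewrite !mevalM !rmorphXn /= xu pu comp_mpoly_meval (meval_eq _ Fu).
  rewrite mulrCA -mulrA; congr (_ * _).
  rewrite (monomial_numeratorE _ a b _ p_neq0) mulfK // invrK mulrCA.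
  by congr (_ ^+ _ * _); have := ltn_ord a; have := ltn_ord b; rewrite /m; lia.
pose Q : {poly C} := \sum_(a < n) (g a b0).@[v] *: 'X^a.
have Q0 : Q = 0.
  apply: (@separable_vanish _ (target_poly v)) => //.
  - by rewrite -size_poly_eq0 szf.
  - by rewrite szf ltnS; apply: size_sum_ord.
  move=> t ft; rewrite /root horner_sum -[X in _ == X](at_root t ft b0).
  by apply/eqP; apply: eq_bigr => a _; rewrite hornerZ hornerXn.
by rewrite -[LHS](coef_sum_ord (fun a => (g a b0).@[v]) a0) -/Q Q0 coef0.
Qed.

Lemma iotaE g : iota g = FracField.tofrac (g \mPo F).
Proof. by []. Qed.

Lemma pullback_fieldE : pullback_field F = fractions_of iota.
Proof.
apply/funext => f; apply/propext; split=> [[g [h [h0 fE]]]|[g [h [h0 fE]]]].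
  by exists g, h; split=> //; rewrite iotaE tofrac_eq0.
by exists g, h; split=> //; rewrite -(@tofrac_eq0 {mpoly C[d]}).
Qed.

Let f : {rmorphism {mpoly C[n]} -> K} :=
  tofrac_comp (comp_mpoly phi : {rmorphism {mpoly C[n]} -> {mpoly C[d]}}).
Let c (j : nat) : K := f (coefT R n j).

Lemma coordinate_pullback (l : 'I_d) : tnth F l = 'X_l \mPo F.
Proof. by rewrite comp_mpolyXU -tnth_nth. Qed.

Lemma coefT_pullback j : exists g, coefT R n j \mPo phi = g \mPo F.
Proof.
have ext i : exists g, extend (tnth F) i = g \mPo F.
  rewrite /extend; case: insubP => [l _ _|_] /=.
    by exists 'X_l; apply: coordinate_pullback.
  by exists 0; rewrite rmorph0.
rewrite coefT_slice /target_coef; case: eqP => _.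
  by have [g ->] := ext (n - k)%N; exists (- g); rewrite rmorphN.
case: eqP => _; first by exists 1; rewrite rmorph1.
case: leqP => _; first by exists (lam j)%:MP; rewrite comp_mpolyC.
by case: leqP => _; [apply: ext|exists 0; rewrite rmorph0].
Qed.

Lemma coef_fraction j : fractions_of iota (c j).
Proof.
have [g gE] := coefT_pullback j.
rewrite (_ : c j = iota g); first exact: fractions_of_iota.
by rewrite iotaE -gE.
Qed.

Lemma top_coef_neq0 : c n != 0.
Proof.
rewrite /c [f _]/(FracField.tofrac (coefT R n n \mPo phi)) tofrac_eq0 coefT_slice.
rewrite /target_coef ifF; last by lia.
rewrite ifF; last by lia.
rewrite ifF; last by lia.
rewrite leqnn; have top : (n - k - 1 < d)%N by lia.
rewrite -[(n - k - 1)%N]/(val (Ordinal top)) extend_ord.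
by rewrite coordinate_pullback; apply/comp_F_neq0/mpolyXU_neq0.
Qed.

Let X : K := f (xc R n).
Let Y : K := f (yc R n).
Let Z (j : nat) : K := f (zc R n j).

Lemma phi_poly_fraction : map_poly f (Phi R n) = phi_poly n (f (half R)%:MP) X Y Z.
Proof. exact: map_PhiE. Qed.

Lemma phi_poly_fraction_coef j : (phi_poly n (f (half R)%:MP) X Y Z)`_j = c j.
Proof. by rewrite -phi_poly_fraction coef_map. Qed.

Lemma marked_p_fraction : 1 + X * Y = FracField.tofrac ps.
Proof. by rewrite tofracD tofrac1 tofracM. Qed.

Lemma tK_relation : \sum_(j < n.+1) c j * tK ^+ j = 0.
Proof.
have p_neq0 : 1 + X * Y != 0 by rewrite marked_p_fraction tofrac_eq0 ps_neq0.
have rootE : (phi_poly n (f (half R)%:MP) X Y Z).[tK] = 0.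
  by rewrite /tK -marked_p_fraction; exact: phi_root.
rewrite -[RHS]rootE.
rewrite (horner_coef_wide _ (size_phi _ _ _ _ n4)).
by apply: eq_bigr => j _; rewrite phi_poly_fraction_coef.
Qed.

Lemma wK_relation : wK ^+ m = \sum_(j < n) j.+1%:R * c j.+1 * tK ^+ j.
Proof.
have p_neq0 : 1 + X * Y != 0 by rewrite marked_p_fraction tofrac_eq0 ps_neq0.
have rootE : (phi_poly n (f (half R)%:MP) X Y Z)^`().[tK] = wK ^+ m.
  by rewrite /tK /wK -marked_p_fraction; exact: phi_deriv_root.
rewrite -[LHS]rootE.
have szd : (size (phi_poly n (f (half R)%:MP) X Y Z)^`() <= n)%N.
  apply/leq_sizeP => j lenj; rewrite coef_deriv.
  by rewrite (leq_sizeP _ _ (size_phi _ _ _ _ n4)) ?mul0rn.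
rewrite (horner_coef_wide _ szd).
by apply: eq_bigr => j _; rewrite coef_deriv phi_poly_fraction_coef mulr_natl.
Qed.

Let e : 'I_(n * m) -> K :=
  mxvec (\matrix_(a < n, b < m) (tK ^+ a * wK ^+ b)) 0.

Lemma basis_mon (a : 'I_n) (b : 'I_m) : e (mxvec_index a b) = tK ^+ a * wK ^+ b.
Proof. by rewrite /e mxvecE mxE. Qed.

Lemma basis_sum (g : 'I_(n * m) -> K) :
  \sum_i g i * e i =
  \sum_a \sum_b g (mxvec_index a b) * (tK ^+ a * wK ^+ b).
Proof.
rewrite (reindex _ (curry_mxvec_bij _ _)) /= pair_bigA /=.
by apply: eq_bigr => [[a b]] _ /=; rewrite basis_mon.
Qed.

Lemma basis_independent (g : 'I_(n * m) -> {mpoly C[d]}) :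
  \sum_i iota (g i) * e i = 0 -> forall i, g i = 0.
Proof.
rewrite (basis_sum (fun i => iota (g i))) => /monomials_independent g0 i.
by case/mxvec_indexP: i => a b; apply: g0.
Qed.

Let S := lspan iota e.

Lemma nat_fraction j : fractions_of iota j%:R.
Proof. by rewrite -(rmorph_nat iota); apply: fractions_of_iota. Qed.

Lemma monomials_in a b : S (tK ^+ a * wK ^+ b).
Proof.
have m0 : (0 < m)%N by rewrite /m; lia.
have small i j : (i < n)%N -> (j < m)%N -> S (tK ^+ i * wK ^+ j).
  move=> ltin ltjm; rewrite -(basis_mon (Ordinal ltin) (Ordinal ltjm)).
  exact: lspan_basis.
apply: (monomials_span m0 _ _ _ nat_fraction _ _ _ small coef_fraction
  top_coef_neq0 tK_relation wK_relation).
- exact: fractions_ofM.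
- move=> g gL; rewrite -mulN1r -(rmorphN1 iota).
  by apply: fractions_ofM => //; apply: fractions_of_iota.
- exact: fractions_ofV.
- exact: lspan0.
- exact: lspanD.
- exact: lspanZ.
Qed.

Lemma span_one : S 1.
Proof. by have := monomials_in 0 0; rewrite !expr0 mulr1. Qed.

Lemma span_basis_mul i j : S (e i * e j).
Proof.
case/mxvec_indexP: i => a b; case/mxvec_indexP: j => a' b'.
by rewrite !basis_mon mulrACA -!exprD; apply: monomials_in.
Qed.

Lemma span_mul (g h : K) : S g -> S h -> S (g * h).
Proof. exact: (@lspanM _ _ iota _ e span_basis_mul g h). Qed.

Lemma span_inv (g : K) : S g -> S g^-1.
Proof. exact: (@lspanV _ _ iota _ e basis_independent span_one span_basis_mul g). Qed.

Lemma span_iota g : S (iota g).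
Proof.
by rewrite -[iota g]mulr1; apply: lspanZ span_one; apply: fractions_of_iota.
Qed.

Lemma span_opp (g : K) : S g -> S (- g).
Proof.
move=> gS; rewrite -mulN1r -(rmorphN1 iota).
by apply: span_mul => //; apply: span_iota.
Qed.

Lemma source_fraction_const a : f a%:MP = iota a%:MP.
Proof.
rewrite iotaE comp_mpolyC [f _]/(FracField.tofrac (a%:MP \mPo phi)).
by rewrite comp_mpolyC.
Qed.

Lemma span_coordinates : [/\ S X, S Y & forall j, (3 <= j <= n)%N -> S (Z j)].
Proof.
have w_neq0 : wK != 0 by rewrite invr_eq0 tofrac_eq0 ps_neq0.
have hE : f (half R)%:MP = iota (half R)%:MP := source_fraction_const _.
have CR := @coordinates_rational K S n (f (half R)%:MP) X Y wK Z n4.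
apply: CR.
- rewrite -(rmorph_nat f) -rmorphM.
  by rewrite -(mpolyC_nat n R[i] 2) -mpolyCM two_half rmorph1.
- exact: lspan0.
- exact: span_one.
- exact: lspanD.
- exact: span_opp.
- exact: span_mul.
- exact: span_inv.
- by rewrite [X]/(FracField.tofrac xs) tofrac_eq0 xs_neq0.
- by rewrite marked_p_fraction /wK invrK.
- by rewrite hE; apply: span_iota.
- by have := monomials_in 1 0; rewrite expr0 mulr1.
- by have := monomials_in 0 1; rewrite expr0 mul1r.
- exact: w_neq0.
- move=> j; rewrite phi_poly_fraction_coef -[c j]mulr1.
  by apply: lspanZ span_one; apply: coef_fraction.
Qed.

Lemma span_source q : S (f q).
Proof.
have [SX SY SZ] := span_coordinates.
elim/mpoly_ring_ind: q => [a|i|q r qS rS|q r qS rS].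
- by rewrite source_fraction_const; apply: span_iota.
- rewrite -coordinate_ord; case: i => [[|[|i]] lt].
  + exact: SX.
  + exact: SY.
  + apply: (SZ i.+3); exact: lt.
- rewrite (rmorphD f q r); exact: (lspanD qS rS).
- rewrite (rmorphM f q r); exact: (span_mul qS rS).
Qed.

(** The coordinates of the slice are polynomials in those of the source. *)
Lemma span_polynomial q : S (FracField.tofrac q).
Proof.
suff -> : FracField.tofrac q = f (q \mPo psi) by apply: span_source.
rewrite [f _]/(FracField.tofrac ((q \mPo psi) \mPo phi)); congr FracField.tofrac.
apply: mpoly_eq => u; rewrite !comp_mpoly_meval; apply: meval_eq => i.
by rewrite -comp_mpoly_meval psi_phi mevalXU.
Qed.

(** The span of the monomials is a field, contains the coordinates of the
    slice, and is therefore the whole function field. *)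
Lemma geometric_degree_slice : geometric_degree F (n * m).
Proof.
rewrite /geometric_degree pullback_fieldE.
apply: (extension_degree_basis basis_independent span_one span_basis_mul) => g.
have [a [b ->]] := fraction_num_den g.
exists (FracField.tofrac a), (FracField.tofrac b).
by split=> //; apply: span_polynomial.
Qed.

End SliceDegree.

(** * Subalgebras generated by a family of polynomials *)

Section GeneratedImage.
Variables (F : closedFieldType) (n : nat) (T : nat -> {mpoly F[n]}).

Definition family (N : nat) : N.-tuple {mpoly F[n]} := [tuple T i | i < N].

Definition generated (N : nat) (f : {mpoly F[n]}) : Prop :=
  exists g : {mpoly F[N]}, f = g \mPo family N.

Variable N : nat.

Lemma generatedC c : generated N c%:MP.
Proof. by exists c%:MP; rewrite comp_mpolyC. Qed.

Lemma generated0 : generated N 0. Proof. exact: (generatedC 0). Qed.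
Lemma generated1 : generated N 1. Proof. exact: (generatedC 1). Qed.

Lemma generatedD f g : generated N f -> generated N g -> generated N (f + g).
Proof. by move=> [a ->] [b ->]; exists (a + b); rewrite rmorphD. Qed.

Lemma generatedN f : generated N f -> generated N (- f).
Proof. by move=> [a ->]; exists (- a); rewrite rmorphN. Qed.

Lemma generatedM f g : generated N f -> generated N g -> generated N (f * g).
Proof. by move=> [a ->] [b ->]; exists (a * b); rewrite rmorphM. Qed.

Lemma generatedX f k : generated N f -> generated N (f ^+ k).
Proof.
move=> fS; elim: k => [|k IHk]; first exact: generated1.
by rewrite exprS; apply: generatedM.
Qed.

Lemma generated_nat k : generated N k%:R.
Proof. by rewrite -(mpolyC_nat n F k); apply: generatedC. Qed.

Lemma generated_sum (I : Type) (r : seq I) (Q : pred I) f :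
  (forall i, Q i -> generated N (f i)) -> generated N (\sum_(i <- r | Q i) f i).
Proof. by apply: big_ind; [apply: generated0|apply: generatedD]. Qed.

Lemma generated_gen i : (i < N)%N -> generated N (T i).
Proof.
move=> ltiN; exists 'X_(Ordinal ltiN).
by rewrite comp_mpolyXU -tnth_nth tnth_mktuple.
Qed.

Variables (i0 : 'I_N) (j0 : 'I_n).
Hypothesis T0 : T i0 = 'X_j0.
Hypothesis onto : forall c : 'I_N -> F, c i0 = 0 ->
  exists u : 'I_n -> F, u j0 = 0 /\ forall i : 'I_N, (T i).@[u] = c i.

(** The point is that [g] vanishes on the hyperplane [X_i0 = 0]: by [onto] each
    point of this hyperplane is the image of a point with [X_j0 = 0]. *)
Lemma family_divX (g : {mpoly F[N]}) a : g \mPo family N = 'X_j0 * a ->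
  exists g', g = 'X_i0 * g' /\ a = g' \mPo family N.
Proof.
move=> gE; have [|g' g'E] := @mpoly_divX F N i0 g.
  move=> c c0; have [u [u0 Tu]] := onto c0.
  have := congr1 (meval u) gE; rewrite mevalM mevalXU u0 mul0r comp_mpoly_meval.
  by move=> <-; apply: meval_eq => i; rewrite tnth_mktuple Tu.
exists g'; split=> //.
apply: (mulfI (mpolyXU_neq0 _ j0)); rewrite -gE g'E rmorphM /=; congr (_ * _).
by rewrite comp_mpolyXU -tnth_nth tnth_mktuple T0.
Qed.

Lemma generated_divX k a : generated N ('X_j0 ^+ k * a) -> generated N a.
Proof.
elim: k => [|k IHk]; first by rewrite mul1r.
rewrite exprS -mulrA => -[g /esym /family_divX [g' [_ aE]]].
by apply: IHk; exists g'.
Qed.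

(** Descent on the degree: a relation is divisible by [X_i0], and the quotient is
    again a relation. *)
Lemma family_injective (g : {mpoly F[N]}) : g \mPo family N = 0 -> g = 0.
Proof.
have [l] := ubnP (msize g); elim: l g => // l IHl g szg g0.
have [|g' [gE /esym g'0]] := @family_divX g 0; first by rewrite mulr0.
rewrite gE; have [->|g'_neq0] := eqVneq g' 0; first by rewrite mulr0.
rewrite (IHl g') ?mulr0 //; move: szg; rewrite gE.
by rewrite msizeM ?mpolyXU_neq0 // msizeX mdeg1.
Qed.

End GeneratedImage.

Lemma generated_widen (F : closedFieldType) n (T : nat -> {mpoly F[n]}) N N' f :
  (N <= N')%N -> generated T N f -> generated T N' f.
Proof.
move=> leN [g ->]; elim/mpoly_ring_ind: g => [c|i|p q Sp Sq|p q Sp Sq].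
- by rewrite comp_mpolyC; apply: generatedC.
- rewrite comp_mpolyXU -tnth_nth tnth_mktuple; apply: generated_gen.
  exact: leq_trans (ltn_ord i) leN.
- by rewrite rmorphD; apply: generatedD.
- by rewrite rmorphM; apply: generatedM.
Qed.

(** * Approximation in powers of x *)

Section Contraction.
Variables (A : comNzRingType) (x : A).

Definition contracting (f : A -> A) :=
  forall a b, exists e, f a - f b = x * (a - b) * e.

Lemma contractingD f g : contracting f -> contracting g ->
  contracting (fun a => f a + g a).
Proof.
move=> fc gc a b; have [e fE] := fc a b; have [e' gE] := gc a b.
by exists (e + e'); rewrite mulrDr -fE -gE; ring.
Qed.

Lemma contractingM c f : contracting f -> contracting (fun a => c * f a).
Proof.
move=> fc a b; have [e fE] := fc a b; exists (c * e).
by rewrite -mulrBr fE; ring.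
Qed.

Lemma contracting_sum (I : Type) (r : seq I) (f : I -> A -> A) :
  (forall i, contracting (f i)) -> contracting (fun a => \sum_(i <- r) f i a).
Proof.
move=> fc; elim: r => [|i r IHr] a b.
  by exists 0; rewrite !big_nil subrr mulr0.
have [e fE] := contractingD (fc i) IHr a b.
by exists e; rewrite !big_cons.
Qed.

Lemma contracting_pow k : contracting (fun a => (1 + x * a) ^+ k).
Proof.
move=> a b; rewrite subrXX; eexists; congr (_ * _).
by rewrite mulrBr; ring.
Qed.

Lemma contracting_mul_self (f : A -> A) : contracting f ->
  (forall a, exists e, f a = x * e) -> contracting (fun a => a * f a).
Proof.
move=> fc fx a b; have [e fE] := fc a b; have [e' aE] := fx a.
exists (e' + b * e).
transitivity ((a - b) * f a + b * (f a - f b)); first by ring.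
by rewrite fE aE; ring.
Qed.

(** Starting from [0], each application of [f] gains a factor [x], until the
    term [x ^+ N * r] is met; one more step shows that the remainder is then [r]
    modulo [x]. *)
Lemma contracting_approx (S : A -> Prop) (f : A -> A) (y r : A) (N : nat) :
  S 0 -> (forall a, S a -> S (f a)) -> contracting f ->
  y = f y + x ^+ N * r ->
  exists h a, S h /\ y = h + x ^+ N * (r + x * a).
Proof.
move=> S0 Sf fc yE.
suff [h [a [Sh hE]]] : exists h a, S h /\ y = h + x ^+ N * a.
  have [e fE] := fc y h; exists (f h), (a * e); split; first exact: Sf.
  have yh : y - h = x ^+ N * a by rewrite hE addrC addKr.
  by rewrite {1}yE -[f y](subrK (f h)) fE yh; ring.
suff main i : (i <= N)%N -> exists h a, S h /\ y = h + x ^+ i * a by exact: main.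
elim: i => [|i IHi] leiN; first by exists 0, y; rewrite expr0; split=> //; ring.
have [h [a [Sh hE]]] := IHi (ltnW leiN).
have [e fE] := fc y h; exists (f h), (a * e + x ^+ (N - i.+1) * r).
split; first exact: Sf.
have yh : y - h = x ^+ i * a by rewrite hE addrC addKr.
rewrite {1}yE -[f y](subrK (f h)) fE yh -(subnKC leiN) exprD exprS.
by rewrite addKn; ring.
Qed.
End Contraction.

(** * The equations for y and z_3 *)

(** The two equations [f t = 0] and [f' t = 1 / p ^+ (n - 2)] at [t = x / p],
    cleared of denominators. *)
Section ClearedRelations.
Variables (n : nat).
Hypothesis n4 : (4 <= n)%N.

Lemma root_relation_field (K : fieldType) (h x y : K) (z : nat -> K) :
  1 + x * y != 0 ->
  \sum_(j < n.+1) (phi_poly n h x y z)`_j * x ^+ j * (1 + x * y) ^+ (n - j) = 0.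
Proof.
move=> p_neq0; have rootE := phi_root n h p_neq0 z; set p := 1 + x * y in p_neq0 *.
rewrite -[RHS](mulr0 (p ^+ n)) -[X in _ * X]rootE.
rewrite (horner_coef_wide _ (size_phi _ _ _ _ n4)) mulr_sumr.
apply: eq_bigr => j _; rewrite -[X in _ = p ^+ X * _](@subnK j n) -1?ltnS //.
have pj := expf_neq0 j p_neq0; rewrite exprD expr_div_n.
by field.
Qed.

Lemma deriv_relation_field (K : fieldType) (h x y : K) (z : nat -> K) :
  1 + x * y != 0 ->
  \sum_(j < n) j.+1%:R * (phi_poly n h x y z)`_j.+1 * x ^+ j
    * (1 + x * y) ^+ (n.-1 - j) = 1 + x * y.
Proof.
move=> p_neq0; have derE := phi_deriv_root h n4 p_neq0 z.
set p := 1 + x * y in p_neq0 derE *.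
transitivity (p ^+ n.-1 * p^-1 ^+ (n - 2)); last first.
  rewrite (_ : n.-1 = (n - 2).+1); last by lia.
  by rewrite exprS exprVn mulfK // expf_neq0.
rewrite -derE.
have szd : (size (phi_poly n h x y z)^`() <= n)%N.
  apply/leq_sizeP => j lenj; rewrite coef_deriv.
  by rewrite (leq_sizeP _ _ (size_phi _ _ _ _ n4)) ?mul0rn.
rewrite (horner_coef_wide _ szd) mulr_sumr; apply: eq_bigr => j _.
rewrite coef_deriv; set c := _`_j.+1; rewrite -[c *+ _]mulr_natl.
have lej : (j <= n.-1)%N by have := ltn_ord j; lia.
rewrite -[X in _ = p ^+ X * _](@subnK j n.-1) //.
have pj := expf_neq0 j p_neq0; rewrite exprD expr_div_n.
by field.
Qed.

Variables (A : idomainType) (h x y : A) (z : nat -> A).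
Hypothesis p_neq0 : 1 + x * y != 0.

Lemma root_relation :
  \sum_(j < n.+1) (phi_poly n h x y z)`_j * x ^+ j * (1 + x * y) ^+ (n - j) = 0.
Proof.
have pF : 1 + FracField.tofrac x * FracField.tofrac y != 0 :> {fraction A}.
  by rewrite -tofracM -tofrac1 -tofracD tofrac_eq0.
apply/eqP; rewrite -tofrac_eq0 rmorph_sum /=; apply/eqP.
rewrite -[RHS](root_relation_field (FracField.tofrac h)
  (fun j => FracField.tofrac (z j)) pF).
rewrite -map_phi; apply: eq_bigr => j _.
by rewrite !tofracM !tofracXn tofracD tofracM tofrac1 coef_map.
Qed.

Lemma deriv_relation :
  \sum_(j < n) j.+1%:R * (phi_poly n h x y z)`_j.+1 * x ^+ j
    * (1 + x * y) ^+ (n.-1 - j) = 1 + x * y.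
Proof.
have pF : 1 + FracField.tofrac x * FracField.tofrac y != 0 :> {fraction A}.
  by rewrite -tofracM -tofrac1 -tofracD tofrac_eq0.
apply/eqP; rewrite -tofrac_eq rmorph_sum /=; apply/eqP.
rewrite tofracD tofrac1 tofracM.
rewrite -[RHS](deriv_relation_field (FracField.tofrac h)
  (fun j => FracField.tofrac (z j)) pF).
rewrite -map_phi; apply: eq_bigr => j _.
by rewrite !tofracM !tofracXn tofracD tofracM tofrac1 coef_map rmorph_nat.
Qed.

End ClearedRelations.

Section FixedPoint.
Variables (A : idomainType) (N : nat) (h x y : A) (z : nat -> A).
Hypotheses (h2 : 2%:R * h = 1) (x_neq0 : x != 0) (p_neq0 : 1 + x * y != 0).
Let n := N.+4.
Let c j := (phi_poly n h x y z)`_j.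

(** [deriv_relation] divided by [x] and solved for [y], without the two terms
    that contain the coefficients of index [n - 1] and [n]; the second sum is
    the part of [(p ^+ (n - 1) - p) / x = y * (p + ... + p ^+ (n - 2))] that
    contracts, the other part being the [(n - 2) y] of [y_relation]. *)
Definition y_step (a : A) : A :=
  - (\sum_(j < N.+1) j.+2%:R * c j.+2 * x ^+ j * (1 + x * a) ^+ (N.+2 - j))
  - a * \sum_(i < N.+2) ((1 + x * a) ^+ i.+1 - 1).

Lemma y_relation : N.+2%:R * y =
  y_step y - x ^+ N.+1 * (N.+3%:R * c N.+3 * (1 + x * y) + N.+4%:R * c N.+4 * x).
Proof.
have := deriv_relation (isT : (4 <= n)%N) h z p_neq0.
rewrite -/c; set p := 1 + x * y.
rewrite big_ord_recl /= mulr1 mul1r subn0 {1}/c phi_coef1 // mul1r.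
rewrite 2!big_ord_recr /= /bump /= !add1n !subSS subnn subSnn expr0 expr1 mulr1.
move=> E; apply: (mulfI x_neq0); apply/eqP; rewrite -subr_eq0; apply/eqP.
have pE : p ^+ N.+3 - p = x * (y * (p * \sum_(i < N.+2) p ^+ i)).
  have p1 : p - 1 = x * y by rewrite /p; ring.
  have pE := subrX1 p N.+2; rewrite p1 in pE.
  transitivity (p * (p ^+ N.+2 - 1)); first by rewrite exprS; ring.
  by rewrite pE; ring.
rewrite /y_step -/p.
have -> : \sum_(i < N.+2) (p ^+ i.+1 - 1) = p * (\sum_(i < N.+2) p ^+ i) - N.+2%:R.
  rewrite sumrB sumr_const card_ord mulr_sumr; congr (_ - _).
  by apply: eq_bigr => i _; rewrite exprS.
move: E; set s := \sum_(i < N.+2) p ^+ i in pE *.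
set u := \sum_(j < N.+1) j.+2%:R * c j.+2 * x ^+ j * p ^+ (N.+2 - j).
rewrite (_ : \sum_(i < N.+1) _ = x * u); last first.
  rewrite mulr_sumr; apply: eq_bigr => j _; rewrite add1n subSS exprS -/(c _).
  by ring.
rewrite -!/(c _) => E.
transitivity (p ^+ N.+3 + (x * u + N.+3%:R * c N.+3 * x ^+ N.+2 * p
   + N.+4%:R * c N.+4 * x ^+ N.+3) - p); last by rewrite E subrr.
rewrite -[p ^+ N.+3](subrK p) pE !exprS; ring.
Qed.

Lemma y_step_contracting : contracting x y_step.
Proof.
have opp f : contracting x f -> contracting x (fun a => - f a).
  move=> fc a b; have [e fE] := fc a b; exists (- e).
  by rewrite mulrN -fE; ring.
apply: contractingD; apply: opp.
  by apply: contracting_sum => j; apply/contractingM/contracting_pow.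
apply: contracting_mul_self => [|a].
  apply: contracting_sum => i a b; have [e eE] := contracting_pow x i.+1 a b.
  by exists e; rewrite -eE; ring.
exists (\sum_(i < N.+2) a * \sum_(j < i.+1) (1 + x * a) ^+ j).
rewrite mulr_sumr; apply: eq_bigr => i _; rewrite subrX1.
by rewrite [1 + _]addrC addrK; ring.
Qed.

(** This is what remains, besides the terms in [z_3] and in the coefficient of
    index [n], when the coefficient of index [n - 1] is eliminated between
    [root_relation] and [deriv_relation]. *)
Definition z_step : A :=
  N.+3%:R * (x - h * n%:R * x ^+ 2 * y) * (1 + x * y) ^+ n - x * (1 + x * y)
  - \sum_(j < N.+2) (N.+2 - j)%:R * c j.+1 * x ^+ j.+1 * (1 + x * y) ^+ (N.+3 - j).

Lemma z_relation : N.+3%:R * h * x ^+ 3 * z 3 * (1 + x * y) ^+ n =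
  z_step + c n * x ^+ n.
Proof.
have n4 : (4 <= n)%N by [].
have := root_relation n4 h z p_neq0; have := deriv_relation n4 h z p_neq0.
rewrite -/(c _) /z_step; set p := 1 + x * y.
rewrite [X in _ -> X = _ -> _]big_ord_recl /= expr0 mulr1 subn0 phi_coef0 //.
move=> D E.
have {D} D : \sum_(j < n) j.+1%:R * c j.+1 * x ^+ j.+1 * p ^+ (N.+3 - j) = x * p.
  rewrite -[in RHS]D mulr_sumr; apply: eq_bigr => j _; rewrite exprS /c /=; ring.
have {E} E : \sum_(j < n) c j.+1 * x ^+ j.+1 * p ^+ (N.+3 - j) =
    (x - h * n%:R * x ^+ 2 * y - h * x ^+ 3 * z 3) * p ^+ n.
  apply/eqP; rewrite -subr_eq0 addrC -mulNr -[X in _ == X]E; apply/eqP.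
  by congr (_ + _); apply: eq_bigr => j _.
have : \sum_(j < n) (N.+3%:R - j.+1%:R) * c j.+1 * x ^+ j.+1 * p ^+ (N.+3 - j) =
   N.+3%:R * ((x - h * n%:R * x ^+ 2 * y - h * x ^+ 3 * z 3) * p ^+ n) - x * p.
  rewrite -E -D mulr_sumr -sumrB; apply: eq_bigr => j _; ring.
rewrite 2!big_ord_recr /= subrr !mul0r addr0 subnn expr0 mulr1.
have n34 : N.+3%:R - N.+4%:R = -1 :> A by ring.
rewrite n34 !mulN1r.
rewrite (_ : \sum_(j < N.+2) _ =
  \sum_(j < N.+2) (N.+2 - j)%:R * c j.+1 * x ^+ j.+1 * p ^+ (N.+3 - j)); last first.
  apply: eq_bigr => j _; congr (_ * _ * _ * _).
  by rewrite natrB; [ring|apply: ltnW; apply: ltn_ord].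
set u := \sum_(j < N.+2) _ => E'.
have -> : c n * x ^+ n = u - (N.+3%:R * ((x - h * n%:R * x ^+ 2 * y
   - h * x ^+ 3 * z 3) * p ^+ n) - x * p).
  by rewrite -E'; ring.
by ring.
Qed.

End FixedPoint.

(** * A coordinate system containing the lower coefficients *)

Section AtZero.
Variables (A : comNzRingType) (n : nat) (h y : A).
Hypothesis n4 : (4 <= n)%N.

Lemma phi_coef_x0 (z : nat -> A) j : (phi_poly n h 0 y z)`_j.+2 =
  (head_poly n 0 y)`_j.+2 + (quot_poly n h 0 y z)`_j.
Proof.
have := phi_coef_rec_up n h 0 y z j.
rewrite expr2 !(mul0r, mulr0, addr0) expr1n mul1r.
by move/eqP; rewrite eq_sym subr_eq0 subr_eq addrC => /eqP.
Qed.

Lemma phi_coef2_x0 (z : nat -> A) :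
  (phi_poly n h 0 y z)`_2 = - (n.-1%:R * y) + n%:R * y * h.
Proof.
have [_ g1] := gpow_coef01 y n.-1.
rewrite phi_coef_x0 quot_coef // /head_poly mulrC linM_coef g1.
by rewrite !(mul0r, mulr0, addr0, subr0) mul1r.
Qed.

Lemma phi_coef_x0_shift (z : nat -> A) j : (3 <= j <= n)%N ->
  (phi_poly n h 0 y z)`_j = (phi_poly n h 0 y (fun=> 0))`_j + z j.
Proof.
case: j => [|[|[|[|j]]]] // jn; rewrite phi_coef_x0 [in RHS]phi_coef_x0 !quot_coef //=.
  by ring.
by rewrite !ifT ?addr0 //; lia.
Qed.

End AtZero.

(** A truncated inverse of a power of [1 + x y], by the geometric series. *)
Lemma truncated_inverse (A : comNzRingType) (x y : A) (n : nat) :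
  let q := (\sum_(i < n.+1) (- (x * y)) ^+ i) ^+ n.+1 in
  (exists e, (1 + x * y) ^+ n.+1 * q = 1 + x ^+ n.+1 * e) /\
  exists e, q = 1 + x * e.
Proof.
move=> q; have pow1 (b d : A) k : exists e, (1 + b * d) ^+ k = 1 + b * e.
  have := subrX1 (1 + b * d) k; rewrite [1 + b * d - 1]addrC addKr => bE.
  by eexists; rewrite -[LHS](subrK 1) bE addrC -mulrA.
split.
  have [e eE] := pow1 (x ^+ n.+1) (- (- y) ^+ n.+1) n.+1.
  exists e; rewrite -eE -exprMn; congr (_ ^+ _).
  have := subrX1 (- (x * y)) n.+1; set s := \sum_(i < n.+1) _ => sE.
  transitivity (- ((- (x * y) - 1) * s)); first by ring.
  by rewrite -sE -mulrN exprMn; ring.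
rewrite /q big_ord_recl expr0.
under eq_bigr => i _ do rewrite exprS -mulrN -mulrA.
by rewrite -mulr_sumr; apply: pow1.
Qed.

Lemma solve_truncated (A : comNzRingType) (k k' X Y s b r u q e : A) :
  k' * k = 1 -> u * q = 1 + X * Y * e -> k * X * r * u = s + b * (X * Y) ->
  X * (r - Y * (k' * q * b - X * r * e)) = k' * q * s.
Proof.
move=> kV uq rel.
transitivity (X * r * (1 + X * Y * e) - k' * q * (b * (X * Y))); first by ring.
have -> : b * (X * Y) = k * X * r * u - s by rewrite rel; ring.
rewrite -uq.
transitivity (X * r * (u * q) - k' * k * X * r * u * q + k' * q * s); first by ring.
by rewrite kV; ring.
Qed.

Section SourceCoordinates.
Variables (R : realType) (N : nat).
Local Notation C := R[i].
Let n := N.+4.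
Local Notation P := {mpoly C[n]}.
Let n4 : (4 <= n)%N := isT.
Let x : P := xc R n.
Let y : P := yc R n.
Let z : nat -> P := zc R n.
Let h : P := (half R)%:MP.
Let c (j : nat) : P := coefT R n j.

Definition source_family (v w : P) (i : nat) : P :=
  if i == 0%N then x else if (i < n - 2)%N then c i.+1
  else if i == (n - 2)%N then v else w.

Lemma xc_var : x = 'X_(Ordinal (isT : (0 < n)%N)).
Proof. by rewrite -coordinate_ord. Qed.

Lemma yc_var : y = 'X_(Ordinal (isT : (1 < n)%N)).
Proof. by rewrite -coordinate_ord. Qed.

Lemma zc_var j (lt : (j.+2 < n)%N) : z j.+3 = 'X_(Ordinal lt).
Proof. by rewrite -coordinate_ord. Qed.

Lemma two_half_mpoly : 2%:R * h = 1.
Proof. by rewrite -(mpolyC_nat n R[i] 2) -mpolyCM two_half. Qed.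

Lemma xc_neq0 : x != 0.
Proof. by rewrite xc_var mpolyXU_neq0. Qed.

Lemma marked_p_neq0 : 1 + x * y != 0.
Proof.
apply/eqP => /(congr1 (meval (fun=> 0))).
rewrite xc_var mevalD meval1 mevalM mevalXU mul0r addr0 meval0.
by move/eqP; rewrite oner_eq0.
Qed.

(** On the hyperplane [x = 0] the coefficients of [T ^ 2], ..., [T ^ n] are
    triangular in [y], [z_3], ..., [z_n]. *)
Lemma coefs_onto (a : nat -> C) : exists u : 'I_n -> C,
  x.@[u] = 0 /\ forall j, (2 <= j <= n)%N -> (c j).@[u] = a j.
Proof.
pose k : C := - n.-1%:R + n%:R * half R.
have k_neq0 : k != 0.
  apply/negP => /eqP k0; have /eqP : 2%:R * k = - N.+2%:R.
    transitivity (- 2%:R * n.-1%:R + 2%:R * half R * n%:R); first by rewrite /k; ring.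
    by rewrite two_half /n /=; ring.
  by rewrite k0 mulr0 eq_sym oppr_eq0 pnatr_eq0.
pose yu := a 2 / k.
pose zu j := a j - (phi_poly n (half R) 0 yu (fun=> 0))`_j.
pose u (i : 'I_n) : C :=
  if val i is i'.+1 then if i' is i''.+1 then zu i.+1 else yu else 0.
have xu : x.@[u] = 0 by rewrite xc_var mevalXU.
have yu' : y.@[u] = yu by rewrite yc_var mevalXU.
have zu' j : (3 <= j <= n)%N -> (z j).@[u] = zu j.
  case: j => [|[|[|j]]] // le; have lt : (j.+2 < n)%N := le.
  by rewrite (zc_var lt) mevalXU.
exists u; split=> // j jn.
have -> : (c j).@[u] = (phi_poly n (half R) 0 yu zu)`_j.
  rewrite (coefT_morph (meval u)).
  rewrite (@phi_poly_eq _ n _ _ _ (fun j => meval u (zc R n j)) zu n4);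
    last exact: zu'.
  rewrite -[LHS]/((phi_poly n (half R)%:MP.@[u] x.@[u] y.@[u] zu)`_j).
  by rewrite xu yu' mevalC.
have [j2|j3] := leqP j 2.
  have -> : j = 2%N by lia.
  rewrite phi_coef2_x0 // (_ : _ + _ = k * yu); last by rewrite /k; ring.
  by rewrite /yu mulrCA mulfV // mulr1.
rewrite (phi_coef_x0_shift _ _ n4); last by lia.
by rewrite /zu addrC subrK.
Qed.

Section Family.
Variables (v w : P) (al be : C) (v' w' : P).
Hypotheses (al0 : al != 0) (be0 : be != 0).
Hypothesis vE : v = al%:MP * c n.-1 + x * v'.
Hypothesis wE : w = be%:MP * c n + x * w'.

(** On the hyperplane [x = 0] the last two functions are nonzero multiples of
    the coefficients of index [n - 1] and [n]. *)
Lemma source_family_onto l (lt0l : (0 < l)%N) : (l <= n)%N ->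
  forall b : 'I_l -> C, b (Ordinal lt0l) = 0 ->
  exists u : 'I_n -> C, u (Ordinal (isT : (0 < n)%N)) = 0 /\
    forall i : 'I_l, (source_family v w i).@[u] = b i.
Proof.
move=> leln b b0.
pose b' i := oapp b 0 (insub i).
have b'E (i : 'I_l) : b' i = b i by rewrite /b' valK.
pose a j := if j == n.-1 then b' (n - 2)%N / al
  else if j == n then b' n.-1 / be else b' j.-1.
have [u [u0 cu]] := coefs_onto a; exists u.
split=> [|i]; first by rewrite -[RHS]u0 xc_var mevalXU.
rewrite /source_family; case: eqP => [i0|i0].
  by rewrite u0 -b0; congr b; apply: val_inj.
have ltin : (i < n)%N := leq_trans (ltn_ord i) leln.
have [lt|ge] := ltnP i (n - 2).
  rewrite cu; last by lia.
  by rewrite /a !ifF ?b'E //; lia.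
case: eqP => [i2|i2].
  rewrite vE mevalD !mevalM mevalC u0 mul0r addr0 cu; last by lia.
  by rewrite /a eqxx -i2 b'E mulrC mulfVK.
have i1 : nat_of_ord i = n.-1 by lia.
rewrite wE mevalD !mevalM mevalC u0 mul0r addr0 cu; last by lia.
rewrite /a ifF; last by lia.
by rewrite eqxx -i1 b'E mulrC mulfVK.
Qed.

End Family.

Lemma x_generated v w l : (0 < l)%N -> generated (source_family v w) l x.
Proof. exact: (@generated_gen _ _ (source_family v w) l 0). Qed.

Lemma lower_generated v w l j : (n - 2 <= l)%N -> (2 <= j <= n - 2)%N ->
  generated (source_family v w) l (c j).
Proof.
move=> lel jn; have -> : c j = source_family v w j.-1.
  rewrite /source_family ifF; last by lia.
  by rewrite ifT; [congr c; lia|lia].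
by apply: generated_gen; lia.
Qed.

Lemma v_generated v w l : (n - 2 < l)%N -> generated (source_family v w) l v.
Proof.
move=> ltl; have {2}-> : v = source_family v w (n - 2).
  by rewrite /source_family ltnn eqxx.
exact: generated_gen.
Qed.

Lemma w_generated v w l : (n.-1 < l)%N -> generated (source_family v w) l w.
Proof.
move=> ltl; have {2}-> : w = source_family v w n.-1.
  rewrite /source_family; case: ifP => [|_]; first by lia.
  by rewrite !ifF //; lia.
exact: generated_gen.
Qed.

Lemma coefT1_mpoly : c 1 = 1. Proof. exact: coefT1. Qed.

Lemma coefT_phi_poly j : c j = (phi_poly n h x y z)`_j. Proof. by []. Qed.

Lemma y_step_generated T l a : generated T l x ->
  (forall j, (2 <= j <= n - 2)%N -> generated T l (c j)) ->
  generated T l a -> generated T l (y_step N h x y z a).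
Proof.
move=> Tx Tc Ta.
have Tp : generated T l (1 + x * a).
  by apply: generatedD; [apply: generated1|apply: generatedM].
apply: generatedD; apply: generatedN.
  apply: generated_sum => j _.
  apply: generatedM; last exact: generatedX.
  apply: generatedM; last exact: generatedX.
  apply: generatedM; first exact: generated_nat.
  rewrite -coefT_phi_poly; apply: (Tc j.+2); exact: (ltn_ord j).
apply: generatedM => //; apply: generated_sum => j _.
by apply: generatedD; [apply: generatedX|apply/generatedN/generated1].
Qed.

Lemma z_step_generated T l : generated T l x -> generated T l y ->
  (forall j, (2 <= j <= n - 2)%N -> generated T l (c j)) ->
  generated T l (z_step N h x y z).
Proof.
move=> Tx Ty Tc.
have Tp : generated T l (1 + x * y).
  by apply: generatedD; [apply: generated1|apply: generatedM].
apply: generatedD; last first.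
  apply: generatedN; apply: generated_sum => j _.
  apply: generatedM; last exact: generatedX.
  apply: generatedM; last exact: generatedX.
  apply: generatedM; first exact: generated_nat.
  have [j0|j0] := posnP j.
    by rewrite j0 -coefT_phi_poly coefT1_mpoly; apply: generated1.
  by rewrite -coefT_phi_poly; apply: (Tc j.+1); rewrite ltnS j0; exact: (ltn_ord j).
apply: generatedD; last by apply/generatedN/generatedM.
apply: generatedM; last exact: generatedX.
apply: generatedM; first exact: generated_nat.
apply: generatedD => //; apply: generatedN; apply: generatedM => //.
apply: generatedM; last exact: generatedX.
by apply: generatedM; [apply: generatedC|apply: generated_nat].
Qed.

(** [contracting_approx] applied to [y_relation] divided by [n - 2]; modulo [x]
    the remainder is a multiple of the coefficient of index [n - 1]. *)
Lemma y_coordinate : exists al v v' h0, [/\ al != 0, v = al%:MP * c n.-1 + x * v',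
  generated (source_family 0 0) (n - 2) h0 & y = h0 + x ^+ N.+1 * v].
Proof.
pose m : C := N.+2%:R; have m0 : m != 0 by rewrite pnatr_eq0.
pose f (a : P) : P := m^-1%:MP * y_step N h x y z a.
pose r : P := - (m^-1%:MP * (N.+3%:R * c N.+3 * (1 + x * y) + N.+4%:R * c N.+4 * x)).
have yE' : y = f y + x ^+ N.+1 * r.
  have mV : m^-1%:MP * N.+2%:R = 1 :> P.
    by rewrite -(mpolyC_nat n C N.+2) -mpolyCM mulVf.
  have rel := @y_relation P N h x y z two_half_mpoly xc_neq0 marked_p_neq0.
  rewrite -[LHS]mul1r -mV -mulrA rel /f /r -!coefT_phi_poly; ring.
pose S := generated (source_family 0 0) (n - 2).
have Sf a : S a -> S (f a).
  move=> Ta; apply: generatedM; first exact: generatedC.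
  apply: y_step_generated => //; first exact: x_generated.
  by move=> j jn; apply: lower_generated.
have fc : contracting x f.
  by apply: contractingM; apply: y_step_contracting.
have [h0 [a [Th hE]]] := contracting_approx (generated0 _ _) Sf fc yE'.
pose v := r + x * a.
exists (- (m^-1 * N.+3%:R)), v,
  (a - m^-1%:MP * (N.+3%:R * c N.+3 * y + N.+4%:R * c N.+4)), h0.
split; [| |exact: Th|exact: hE].
  by rewrite oppr_eq0 mulf_neq0 // ?invr_eq0 // pnatr_eq0.
rewrite /v /r mpolyCN mpolyCM mpolyC_nat -/n; ring.
Qed.

Lemma generated_eq (T T' : nat -> P) l g : (forall i, (i < l)%N -> T i = T' i) ->
  generated T l g -> generated T' l g.
Proof.
move=> eqT [q ->]; exists q; congr (q \mPo _).
by apply: eq_from_tnth => i; rewrite !tnth_mktuple eqT.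
Qed.

(** [z_relation] multiplied by a truncated inverse of [p ^+ n]: up to a multiple
    of [x ^+ n], the left-hand side becomes a multiple of [x ^+ 3 * z_3]. *)
Lemma z_coordinate v : (forall w, generated (source_family v w) n.-1 y) ->
  exists be w w', [/\ be != 0, w = be%:MP * c n + x * w' &
    exists W, generated (source_family v w) n.-1 (x ^+ 3 * W) /\
      z 3 = W + x ^+ N.+1 * w].
Proof.
move=> Ty; have [[e qE] [e' qE']] := truncated_inverse x y N.+3.
set q := (\sum_(i < N.+4) (- (x * y)) ^+ i) ^+ N.+4 in qE qE'.
have rel := @z_relation P N h x y z marked_p_neq0.
rewrite -/n -(coefT_phi_poly n) in rel.
pose k : C := N.+3%:R * half R.
have k0 : k != 0 by rewrite mulf_neq0 ?invr_eq0 ?pnatr_eq0.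
pose w : P := k^-1%:MP * q * c n - x ^+ 3 * z 3 * e.
have kV : k^-1%:MP * (N.+3%:R * h) = 1.
  by rewrite -(mpolyC_nat n C N.+3) -!mpolyCM mulVf.
have xn : x ^+ n = x ^+ 3 * x ^+ N.+1 by rewrite -exprD.
rewrite xn in rel qE.
have main : x ^+ 3 * (z 3 - x ^+ N.+1 * w) = k^-1%:MP * q * z_step N h x y z.
  apply: solve_truncated.
  - exact: kV.
  - exact: qE.
  exact: rel.
exists k^-1, w, (k^-1%:MP * e' * c n - x ^+ 2 * z 3 * e); split.
- by rewrite invr_eq0.
- by rewrite /w qE'; ring.
exists (z 3 - x ^+ N.+1 * w); split; last by rewrite subrK.
rewrite main; have Tx : generated (source_family v w) n.-1 x by apply: x_generated.
have {}Ty := Ty w.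
apply: generatedM; last first.
  apply: z_step_generated => // j jn; apply: lower_generated => //; lia.
apply: generatedM; first exact: generatedC.
apply: generatedX; apply: generated_sum => i _; apply: generatedX.
by apply/generatedN/generatedM.
Qed.

(** The family is algebraically independent by [family_injective], and it
    generates [y], then [z_3], after a division by [x ^+ 3], and then the other
    [z_j] by [coordinates_in]; both kinds of division stay in the generated
    subalgebra by [generated_divX]. *)
Lemma source_automorphism : exists (v w : P) (G : n.-tuple P),
  inverse_maps (source_coordinates v w) G.
Proof.
have [al [v [v' [h0 [al0 vE Th0 yE']]]]] := y_coordinate.
have Ty w l : (n.-1 <= l)%N -> generated (source_family v w) l y.
  move=> lel; rewrite yE'; apply: generatedD.
    apply: (generated_widen (N := (n - 2)%N)); first by lia.
    apply: generated_eq Th0 => i lti; rewrite /source_family.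
    by rewrite lti.
  apply: generatedM; first by apply/generatedX/x_generated; lia.
  by apply: v_generated; lia.
have [be [w [w' [be0 wE [W [TW zE']]]]]] := z_coordinate (fun w => Ty w _ (leqnn _)).
have onto l lt0l leln := @source_family_onto v w al be v' w' al0 be0 vE wE l lt0l leln.
have T0 : source_family v w 0 = 'X_(Ordinal (isT : (0 < n)%N)) by exact: xc_var.
have Tz3 : generated (source_family v w) n (z 3).
  rewrite zE'; apply: generatedD.
    apply: (generated_widen (N := n.-1)); first by lia.
    have lt0 : (0 < n.-1)%N by [].
    have D := @generated_divX _ _ _ _ (Ordinal lt0) _ T0 (onto _ lt0 (leq_pred n)) 3.
    by apply: D; rewrite -xc_var.
  apply: generatedM; first by apply/generatedX/x_generated.
  by apply: w_generated.
have lt0 : (0 < n)%N by [].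
have Tx := x_generated v w lt0.
have Tyn := Ty w n (leq_pred n).
have Tz : forall j, (3 <= j <= n)%N -> generated (source_family v w) n (z j).
  apply: (@coordinates_in P (generated (source_family v w) n) (generated0 _ _)
    (generated1 _ _) (@generatedD _ _ _ _) (@generatedN _ _ _ _)
    (@generatedM _ _ _ _) n h x y z n4 (generatedC _ _ _) Tx Tyn Tz3).
    move=> a; rewrite xc_var.
    by apply: (@generated_divX _ _ _ _ (Ordinal lt0) _ T0 (onto _ lt0 (leqnn _))).
  move=> j jn; rewrite -coefT_phi_poly; apply: lower_generated => //; lia.
have /choice [g gE] : forall i : 'I_n, generated (source_family v w) n 'X_i.
  move=> i; rewrite -coordinate_ord; case: i => [[|[|i]] lt].
  - exact: Tx.
  - exact: Tyn.
  - by apply: (Tz i.+3); exact: lt.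
exists v, w, [tuple g i | i < n].
have GT : comp_map [tuple g i | i < n] (source_coordinates v w) = id_map R n.
  by apply: eq_from_tnth => i; rewrite !tnth_mktuple gE.
split; last exact: GT.
have inj := @family_injective _ _ (source_family v w) n (Ordinal lt0) _ T0
  (onto _ lt0 (leqnn _)).
(* Composed with the family itself, both sides give the [i]-th coordinate. *)
apply: eq_from_tnth => i; rewrite !tnth_mktuple; apply/eqP; rewrite -subr_eq0.
apply/eqP/inj; rewrite rmorphB /=; apply/eqP; rewrite subr_eq0; apply/eqP.
apply: mpoly_eq => u; rewrite [LHS]comp_mpoly_meval comp_mpoly_meval.
rewrite comp_mpoly_meval mevalXU tnth_mktuple; apply: meval_eq => l.
have := congr1 (fun t : n.-tuple P => (tnth t l).@[u]) GT.
rewrite !tnth_mktuple mevalXU => GTl; rewrite -[RHS]GTl comp_mpoly_meval.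
by apply: meval_eq => l'; rewrite !tnth_mktuple.
Qed.

End SourceCoordinates.

(** * Slices *)

Section Slices.
Variables (R : realType) (N : nat).
Local Notation C := R[i].
Let n := N.+4.
Variables (v w : {mpoly C[n]}) (G : n.-tuple {mpoly C[n]}).
Hypothesis TG : inverse_maps (source_coordinates v w) G.
Let T := source_family v w.

Variables (k d : nat) (lam : nat -> C).
Hypotheses (k1 : (1 <= k)%N) (kn : (k <= n - 2)%N) (dE : d = (n - k + 1)%N).

(** The slice in the coordinates of the automorphism, where it is an affine
    subspace. *)
Definition slice_embedding : n.-tuple {mpoly C[d]} :=
  [tuple if i == 0%N :> nat then coordinate R d 0
         else if (i < k)%N then (lam i.+1)%:MP
         else coordinate R d (i - k + 1) | i < n].

Definition slice_param : n.-tuple {mpoly C[d]} := comp_map G slice_embedding.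

Definition slice_coord : d.-tuple {mpoly C[n]} :=
  [tuple if i == 0%N :> nat then xc R n else T (i + k - 1) | i < d].

Lemma family_slice (i : 'I_n) : T i \mPo slice_param = tnth slice_embedding i.
Proof.
have [TG1 _] := TG.
apply: mpoly_eq => u; rewrite comp_mpoly_meval.
rewrite -[RHS](mevalXU (fun l => (tnth slice_embedding l).@[u])).
have <- : T i \mPo G = 'X_i.
  have := congr1 (fun t : n.-tuple {mpoly C[n]} => tnth t i) TG1.
  by rewrite !tnth_mktuple.
rewrite comp_mpoly_meval; apply: meval_eq => l.
by rewrite tnth_mktuple comp_mpoly_meval.
Qed.

Lemma coefT_family j : (2 <= j <= n - 2)%N -> coefT R n j = T j.-1.
Proof.
move=> jn; rewrite /T /source_family ifF; last by lia.
by rewrite ifT; [congr coefT; lia|lia].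
Qed.

Lemma slice_lower j : (2 <= j <= k)%N -> coefT R n j \mPo slice_param = (lam j)%:MP.
Proof.
move=> jk; have lt : (j.-1 < n)%N by lia.
rewrite coefT_family; last by lia.
rewrite (family_slice (Ordinal lt)) tnth_mktuple /= ifF; last by lia.
by rewrite ifT; [congr (lam _)%:MP; lia|lia].
Qed.

Lemma slice_coord_param i : tnth slice_coord i \mPo slice_param = 'X_i.
Proof.
rewrite tnth_mktuple; have [i0|i0] := eqVneq (nat_of_ord i) 0%N.
  rewrite (family_slice (Ordinal (isT : (0 < n)%N))) tnth_mktuple /=.
  by rewrite -i0 coordinate_ord.
have lt : (i + k - 1 < n)%N by have := ltn_ord i; lia.
rewrite (family_slice (Ordinal lt)) tnth_mktuple /= ifF; last by lia.
rewrite ifF; last by lia.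
by rewrite (_ : (i + k - 1 - k + 1)%N = i) ?coordinate_ord //; lia.
Qed.

Lemma slice_param_coord (P : 'I_n -> C) :
  (forall j, (2 <= j <= k)%N -> (coefT R n j).@[P] = lam j) ->
  forall i, (tnth slice_param i).@[fun l => (tnth slice_coord l).@[P]] = P i.
Proof.
have [_ GT] := TG; move=> lowP i; rewrite tnth_mktuple comp_mpoly_meval.
have := congr1 (fun t : n.-tuple {mpoly C[n]} => (tnth t i).@[P]) GT.
rewrite !tnth_mktuple mevalXU comp_mpoly_meval => <-; apply: meval_eq => l.
rewrite !tnth_mktuple -/(source_family v w l) -/T.
have d0 : (0 < d)%N by lia.
have [l0|l0] := eqVneq (nat_of_ord l) 0%N.
  by rewrite l0 -[0%N]/(val (Ordinal d0)) coordinate_ord mevalXU tnth_mktuple.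
have [ltlk|lekl] := ltnP l k.
  rewrite mevalC -lowP; last by lia.
  by rewrite coefT_family //; lia.
have ltd : (l - k + 1 < d)%N by have := ltn_ord l; lia.
rewrite -[(l - k + 1)%N]/(val (Ordinal ltd)) coordinate_ord mevalXU tnth_mktuple.
by rewrite /= ifF; [congr (T _).@[_]; lia|lia].
Qed.

Lemma keller_degree_slice (F : d.-tuple {mpoly C[d]}) :
  (forall i : 'I_d, tnth F i =
    (if (i < n - k)%N then coefT R n (k + 1 + i) else A0 R n) \mPo slice_param) ->
  keller F /\ geometric_degree F (n * (n - 2)).
Proof.
move=> FE; have n4 : (4 <= n)%N by [].
split.
  exact: (keller_slice n4 k1 kn dE slice_coord_param slice_lower FE).
exact: (geometric_degree_slice n4 k1 kn dE slice_coord_param slice_param_coord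
  slice_lower FE).
Qed.

Lemma slice_isomorphism (V : {ffun 'I_n -> C} -> Prop) :
  (forall P, V P <-> forall j, (2 <= j <= k)%N -> (coefT R n j).@[P] = lam j) ->
  isomorphism_onto slice_param V.
Proof.
move=> VE; exists slice_coord; split=> [u|P /VE lowP]; last first.
  apply/ffunP => i; rewrite ffunE -[RHS](slice_param_coord lowP).
  by apply: meval_eq => l; rewrite ffunE.
split; last first.
  apply/ffunP => i; rewrite ffunE -[RHS](mevalXU u) -slice_coord_param.
  by rewrite comp_mpoly_meval; apply: meval_eq => l; rewrite ffunE.
apply/VE => j jk; rewrite -[RHS](mevalC u) -(slice_lower jk) comp_mpoly_meval.
by apply: meval_eq => l; rewrite ffunE.
Qed.

End Slices.

Theorem theorem1p1 (R : realType) (n : nat) (hn : (4 <= n)%N) :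
  (exists (s s' : {mpoly R[i][n]}) (G : n.-tuple {mpoly R[i][n]}),
      inverse_maps (source_coordinates s s') G /\
      forall lam : (n - 3).-tuple R[i],
        keller (E_map G lam) /\
        geometric_degree (E_map G lam) (n * (n - 2))) /\
  (forall k : nat, (1 <= k <= n - 2)%N ->
    forall lam : (k - 1).-tuple R[i],
      exists phi : n.-tuple {mpoly R[i][n - k + 1]},
        isomorphism_onto phi (locus lam) /\
        keller (comp_map (remaining R n k) phi) /\
        geometric_degree (comp_map (remaining R n k) phi) (n * (n - 2))).
Proof.
case: n hn => [|[|[|[|N]]]] // _; have [v [w [G TG]]] := source_automorphism R N.
split.
  exists v, w, G; split=> // lam.
  have k1 : (1 <= N.+4 - 2)%N by lia.
  have dE : 3 = (N.+4 - (N.+4 - 2) + 1)%N by lia.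
  pose l j := lam`_(j - 2)%N.
  have sliceE : slice lam = slice_embedding N (N.+4 - 2) 3 l.
    apply: eq_from_tnth => i; rewrite !tnth_mktuple; case: ifP => // i0.
    case: ifP => // ltin; have := ltn_ord i.
    by case: eqP => [->|neq] lt; congr coordinate; lia.
  apply: (keller_degree_slice TG (lam := l) k1 (leqnn _) dE) => i.
  rewrite tnth_mktuple sliceE.
  rewrite (_ : (N.+4 - (N.+4 - 2))%N = 2%N); last by lia.
  have k1E : (N.+4 - 2 + 1)%N = N.+3 by lia.
  rewrite -/(slice_param G (N.+4 - 2) 3 l) k1E.
  case: i => [[|[|[|i]]] lt]; last by exfalso; move: lt; rewrite ltnNge.
  - rewrite -[LHS]/(coefT R N.+4 N.+3 \mPo _) -[RHS]/(coefT R N.+4 (N.+3 + 0) \mPo _).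
    by rewrite addn0.
  - rewrite -[LHS]/(coefT R N.+4 N.+4 \mPo _) -[RHS]/(coefT R N.+4 (N.+3 + 1) \mPo _).
    by rewrite addn1.
  - by rewrite -[LHS]/(A0 R N.+4 \mPo _) -[RHS]/(A0 R N.+4 \mPo _).
move=> k /andP[k1 kn] lam; pose l j := lam`_(j - 2)%N.
exists (slice_param G k (N.+4 - k + 1) l); split.
  by apply: (slice_isomorphism TG k1 kn erefl) => P.
apply: (keller_degree_slice TG (lam := l) k1 kn erefl) => i.
by rewrite !tnth_mktuple.
Qed.
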